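(* Let $\alpha,\beta\in\mathbb{C}\setminus\{-1,-2,\ldots\}$ with $\Re\alpha+\Re\beta>-1$, let $1\le p\le+\infty$, and let $k,l\ge 0$ be integers. There is a constant $C_{\alpha,\beta,k,l,p}$, depending only on $\alpha,\beta,k,l,p$, such that for every $\varphi\in L^p(\mathbb{T})$, with $u=P_{\alpha,\beta}[\varphi]$, and every $z\in\mathbb{D}$, $$\left|\partial^k\overline\partial^l u(z)\right|\le C_{\alpha,\beta,k,l,p}\,\frac{\|\varphi\|_p}{(1-|z|^2)^{k+l+\frac1p}},$$ where $\frac1p=0$ if $p=+\infty$.
   Context: $\mathbb{D}$ is the open unit disc in $\mathbb{C}$, $\mathbb{T}=\partial\mathbb{D}$, and $m$ is the arc-length measure on $\mathbb{T}$ normalized so that $m(\mathbb{T})=1$; $L^p(\mathbb{T})$ and $\|\cdot\|_p$ are taken with respect to $m$ (complex-valued functions). Write $\partial=\partial_z=\frac12\left(\frac{\partial}{\partial x}-i\frac{\partial}{\partial y}\right)$ and $\overline\partial=\partial_{\overline z}=\frac12\left(\frac{\partial}{\partial x}+i\frac{\partial}{\partial y}\right)$. For $\alpha,\beta\in\mathbb{C}$ put $$u_{\alpha,\beta}(z)=\frac{(1-|z|^2)^{\alpha+\beta+1}}{(1-z)^{\alpha+1}(1-\overline z)^{\beta+1}},\qquad |z|<1,$$ with principal branches of the powers. For $\alpha,\beta\in\mathbb{C}\setminus\{-1,-2,\dots\}$ with $\Re\alpha+\Re\beta>-1$ put $$c_{\alpha,\beta}=\frac{\Gamma(\alpha+1)\Gamma(\beta+1)}{\Gamma(\alpha+\beta+1)},$$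 and for $f\in L^1(\mathbb{T})$ define the $(\alpha,\beta)$-Poisson integral $$P_{\alpha,\beta}[f](z)=\int_{\mathbb{T}}c_{\alpha,\beta}\,u_{\alpha,\beta}(z\overline\zeta)f(\zeta)\,dm(\zeta),\qquad z\in\mathbb{D}.$$ *)

(* Defs.v *)
From HB Require Import structures.
From mathcomp Require Import all_boot all_order all_algebra.
From mathcomp Require Import complex.
From mathcomp Require Import all_classical all_reals all_analysis.
From mathcomp Require Import measurable_realfun.
From mathcomp Require Import lra.

Set Implicit Arguments.
Unset Strict Implicit.
Unset Printing Implicit Defensive.

Import Order.TTheory GRing.Theory Num.Theory.
Import numFieldNormedType.Exports.

Local Open Scope classical_set_scope.
Local Open Scope ring_scope.
Local Open Scope complex_scope.

(* `|z| is an element of R[i]; cabs z is the same modulus as an element of R. *)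
Notation cabs := Normc.normc.

Section ComplexFunctions.
Variable R : realType.
Implicit Types z w : R[i].

Definition cexp z : R[i] :=
  (expR (complex.Re z))%:C * (cos (complex.Im z) +i* sin (complex.Im z)).

(* Principal argument, with values in ]-pi, pi]; the value at 0 is junk. *)
Definition carg z : R :=
  let: x +i* y := z in
  if 0 < x then atan (y / x)
  else if x < 0 then (if 0 <= y then atan (y / x) + pi else atan (y / x) - pi)
  else if 0 < y then pi / 2 else - (pi / 2).

Definition clog z : R[i] := ln (cabs z) +i* carg z.

Definition cpow z w : R[i] := cexp (w * clog z).

(* Gauss' product limit n! n^z / (z (z + 1) ... (z + n)), which converges to
   Gamma(z) for every complex z outside {0, -1, -2, ...}. *)
Definition cGamma z : R[i] :=
  lim ((fun n : nat => (n`!%:R * cpow n%:R z / \prod_(j < n.+1) (z + j%:R)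
        : R[i]^o)) @ \oo).

End ComplexFunctions.

Section Circle.
Variable R : realType.

Definition circle : Type := {z : R[i] | cabs z == 1}.

HB.instance Definition _ := Choice.on circle.

Lemma cabs_expi (t : R) : cabs (cos t +i* sin t) == 1.
Proof. by rewrite /Normc.normc cos2Dsin2 sqrtr1. Qed.

Definition expi (t : R) : circle := exist _ (cos t +i* sin t) (cabs_expi t).

HB.instance Definition _ := isPointed.Build circle (expi 0).

(* R[i]^o carries the topology of the complex plane. *)
Definition circle_open : set (set circle) :=
  [set A | exists2 U : set R[i]^o, open U & A = [set z : circle | U (sval z)]].

(* The circle with its Borel sigma-algebra. *)
Definition borel_circle := g_sigma_algebraType circle_open.

HB.instance Definition _ := Measurable.on borel_circle.

Definition expiT (t : measurableTypeR R) : borel_circle := expi t.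

Lemma measurable_expiT : measurable_fun [set: measurableTypeR R] expiT.
Proof.
apply: (@measurability _ _ (measurableTypeR R) borel_circle setT expiT
  circle_open) => //.
move=> _ [_ [U oU ->] <-]; rewrite setTI.
apply: open_measurable; rewrite openE /= => t Ut.
move: oU; rewrite openE => /(_ _ Ut).
rewrite /interior /= -nbhs_ballE => -[/= e e0 eU].
case: e e0 eU => a b; rewrite ltcE /= => /andP[/eqP -> a0] eU.
have a2 : 0 < a / 2 by rewrite divr_gt0.
have /cvgrPdist_lt/(_ _ a2) cost := @continuous_cos R t.
have /cvgrPdist_lt/(_ _ a2) sint := @continuous_sin R t.
near=> s; apply: eU; rewrite /ball /= normc_def /= ltcR.
rewrite -[ltRHS](gtr0_norm a0) -sqrtr_sqr.
have cs : `|cos t - cos s| < a / 2 by near: s.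
have ss : `|sin t - sin s| < a / 2 by near: s.
rewrite ltr_sqrt ?exprn_gt0 ?normr_gt0 ?gt_eqF//.
move: cs ss; rewrite !ltr_norml => /andP[? ?] /andP[? ?].
by rewrite -[ltLHS]/((cos t - cos s) ^+ 2 + (sin t - sin s) ^+ 2); nra.
Unshelve. all: by end_near. Qed.

HB.instance Definition _ := isMeasurableFun.Build _ _ _ _
  expiT measurable_expiT.

Lemma twopi_gt0 : (0 : R) < 2 * pi.
Proof. by rewrite mulr_gt0 // pi_gt0. Qed.

(* Normalized arc length: the image of the uniform probability dt / (2 pi) on
   [0, 2 pi] under t |-> e^{it}. *)
Definition arc_measure : probability borel_circle R :=
  distribution (uniform_prob twopi_gt0) expiT.

Definition circle_integral (f : borel_circle -> R[i]) : R[i] :=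
  Rintegral arc_measure [set: _] (fun s => complex.Re (f s)) +i*
  Rintegral arc_measure [set: _] (fun s => complex.Im (f s)).

Definition circle_norm (p : \bar R) (f : borel_circle -> R[i]) : \bar R :=
  Lnorm arc_measure p (fun s => (cabs (f s))%:E).

Definition in_Lp (p : \bar R) (f : borel_circle -> R[i]) : Prop :=
  [/\ measurable_fun [set: borel_circle] (fun s => complex.Re (f s)),
      measurable_fun [set: borel_circle] (fun s => complex.Im (f s)) &
      (circle_norm p f < +oo)%E].

End Circle.

Section Wirtinger.
Variable R : realType.
Implicit Types (u : R[i] -> R[i]) (z v : R[i]).

(* Derivative of u at z along the real line z + R v. *)
Definition derive_along v u z : R[i] :=
  derive1 (fun t : R => complex.Re (u (z + t%:C * v))) 0 +i*
  derive1 (fun t : R => complex.Im (u (z + t%:C * v))) 0.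

Definition derivable_along v u z : Prop :=
  derivable (fun t : R => complex.Re (u (z + t%:C * v))) 0 1 /\
  derivable (fun t : R => complex.Im (u (z + t%:C * v))) 0 1.

Definition has_partials u z : Prop :=
  derivable_along 1 u z /\ derivable_along (0 +i* 1) u z.

Definition dz u z : R[i] :=
  2^-1 * (derive_along 1 u z - (0 +i* 1) * derive_along (0 +i* 1) u z).

Definition dzbar u z : R[i] :=
  2^-1 * (derive_along 1 u z + (0 +i* 1) * derive_along (0 +i* 1) u z).

Definition dz_dzbar (k l : nat) u : R[i] -> R[i] := iter k dz (iter l dzbar u).

(* The derivatives above are total functions, with junk values where a limit
   does not exist. This says that every derivation performed in computing
   dz_dzbar k l u on the unit disc is a genuine one. *)
Definition dz_dzbar_exists (k l : nat) u : Prop :=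
  forall z, cabs z < 1 ->
    (forall j, (j < l)%N -> has_partials (dz_dzbar 0 j u) z) /\
    (forall j, (j < k)%N -> has_partials (dz_dzbar j l u) z).

End Wirtinger.

Section PoissonIntegral.
Variable R : realType.
Implicit Types (alpha beta z : R[i]).

Definition u_kernel alpha beta z : R[i] :=
  cpow (1 - (cabs z ^+ 2)%:C) (alpha + beta + 1) /
  (cpow (1 - z) (alpha + 1) * cpow (1 - conjc z) (beta + 1)).

Definition c_const alpha beta : R[i] :=
  cGamma (alpha + 1) * cGamma (beta + 1) / cGamma (alpha + beta + 1).

Definition poisson alpha beta (f : borel_circle R -> R[i]) z : R[i] :=
  circle_integral (fun s =>
    c_const alpha beta * u_kernel alpha beta (z * conjc (sval s)) * f s).

End PoissonIntegral.

(* Main.v *)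
(** The derivative of an integral along a real line is the integral of the
derivative of the kernel, so everything reduces to the kernel U(z,s) given by
u_(alpha,beta)(z conj(s)). Put A = 1 - |z|^2, B = 1 - z conj(s), D = conj(B)
and sg = Re alpha + Re beta + 1 > 0. Logarithmic differentiation of
U = A^(alpha+beta+1) B^(-alpha-1) D^(-beta-1) shows that every derivative of U
of order n is U times a polynomial in z, conj(z), s, conj(s), 1/A, 1/B, 1/D of
weight n in the last three, hence is bounded by C A^(-n) K with
K = A^sg / |B|^(sg+1). Since |B| >= A/2 the majorant K is at most C/A, and its
integral over the circle is bounded uniformly in z; interpolating between these
two facts gives the bound C A^(-1/p) ||phi||_p for the integral of K |phi|.
The constant c_(alpha,beta) is just a number: no property of Gamma is used. *)

Require Import Defs.
From HB Require Import structures.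
From mathcomp Require Import all_boot all_order all_algebra.
From mathcomp Require Import complex.
From mathcomp Require Import all_classical all_reals all_analysis.
From mathcomp Require Import measurable_realfun ring lra.

Set Implicit Arguments.
Unset Strict Implicit.
Unset Printing Implicit Defensive.

Import Order.TTheory GRing.Theory Num.Theory.
Import numFieldNormedType.Exports.

Local Open Scope classical_set_scope.
Local Open Scope ring_scope.
Local Open Scope complex_scope.

Local Notation Re := complex.Re.
Local Notation Im := complex.Im.

(** * Complex-valued curves *)

Section Curves.
Variable R : realType.
Implicit Types (g h : R -> R[i]) (t : R) (a b w : R[i]).

(** [dz] and [dzbar] are total operators built from componentwise real derivatives; they must be
    iterated while keeping differentiability genuine and the constant free of phi. This calls for a
    class of integrals closed under differentiation: U f against phi, with f rational of a given
    weight and produced before phi is chosen. Principal branches are harmless because A, B, D lie in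
    the right half-plane: the logarithm is smooth there and arguments are at most pi/2 in modulus,
    so imaginary parts of the exponents cost only a bounded factor. The uniform integral bound on K
    is a scale-invariant comparison: at angular distance t from z, K is at most a multiple of d^sg
    (d + t)^(-sg-1) with d = A, whose primitive is elementary and whose mass, up to the factor 1/sg,
    does not depend on d. *)

Lemma cReM a b : Re (a * b) = Re a * Re b - Im a * Im b.
Proof. by case: a; case: b. Qed.

Lemma cImM a b : Im (a * b) = Re a * Im b + Im a * Re b.
Proof. by case: a; case: b. Qed.

Lemma cReD a b : Re (a + b) = Re a + Re b.
Proof. by case: a; case: b. Qed.

Lemma cImD a b : Im (a + b) = Im a + Im b.
Proof. by case: a; case: b. Qed.

Lemma cReN a : Re (- a) = - Re a.
Proof. by case: a. Qed.

Lemma cImN a : Im (- a) = - Im a.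
Proof. by case: a. Qed.

Lemma cReV a : Re a^-1 = Re a / (Re a ^+ 2 + Im a ^+ 2).
Proof. by case: a. Qed.

Lemma cImV a : Im a^-1 = - (Im a / (Re a ^+ 2 + Im a ^+ 2)).
Proof. by case: a => x y /=; rewrite -mulNr. Qed.

Lemma cReJ a : Re (conjc a) = Re a.
Proof. by case: a. Qed.

Lemma cImJ a : Im (conjc a) = - Im a.
Proof. by case: a. Qed.

Lemma complex_ext a b : Re a = Re b -> Im a = Im b -> a = b.
Proof. by case: a => ? ?; case: b => ? ? /= -> ->. Qed.

Lemma normc_sqr a : cabs a ^+ 2 = Re a ^+ 2 + Im a ^+ 2.
Proof. by case: a => x y; rewrite sqr_sqrtr// addr_ge0 ?sqr_ge0. Qed.

Lemma normc_ge0 a : 0 <= cabs a.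
Proof. by case: a => x y; exact: sqrtr_ge0. Qed.

Lemma ler_abs_sqr (x y : R) : 0 <= y -> x ^+ 2 <= y ^+ 2 -> `|x| <= y.
Proof. by move=> y0 xy; rewrite -(ger0_norm y0) -ler_sqr ?nnegrE// !real_normK// num_real. Qed.

Lemma Re_le_normc a : `|Re a| <= cabs a.
Proof. by apply: ler_abs_sqr (normc_ge0 _) _; rewrite normc_sqr lerDl sqr_ge0. Qed.

Lemma Im_le_normc a : `|Im a| <= cabs a.
Proof. by apply: ler_abs_sqr (normc_ge0 _) _; rewrite normc_sqr lerDr sqr_ge0. Qed.

Lemma normc_le_ReIm a : cabs a <= `|Re a| + `|Im a|.
Proof.
rewrite -ler_sqr ?nnegrE ?normc_ge0 ?addr_ge0// normc_sqr.
rewrite -(real_normK (num_real (Re a))) -(real_normK (num_real (Im a))).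
have := normr_ge0 (Re a); have := normr_ge0 (Im a); nra.
Qed.

(** The components are differentiated separately, to match [derive_along]; as a relation it records
    existence and value at once. *)
Definition cderiv g t (dg : R[i]) : Prop :=
  is_derive t 1 (fun s => Re (g s)) (Re dg) /\
  is_derive t 1 (fun s => Im (g s)) (Im dg).

Lemma cderiv_eq g t a b : cderiv g t a -> a = b -> cderiv g t b.
Proof. by move=> ? <-. Qed.

Lemma near_eq_cderiv g h t a :
  (\near t, g t = h t) -> cderiv g t a -> cderiv h t a.
Proof.
move=> gh [gr gi]; split.
- by apply: near_eq_is_derive gr; near do congr Re.
- by apply: near_eq_is_derive gi; near do congr Im.
Unshelve. all: by end_near. Qed.

Lemma cderiv_cst t a : cderiv (fun=> a) t 0.
Proof. by split; exact: is_derive_cst. Qed.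

Lemma cderivD g h t a b :
  cderiv g t a -> cderiv h t b -> cderiv (fun s => g s + h s) t (a + b).
Proof.
move=> [gr gi] [hr hi]; split.
- under eq_fun do rewrite cReD.
  by rewrite cReD; exact: is_deriveD.
- under eq_fun do rewrite cImD.
  by rewrite cImD; exact: is_deriveD.
Qed.

Lemma is_derive_congr (g h : R -> R) t (a b : R) :
  is_derive t 1 g a -> g =1 h -> a = b -> is_derive t 1 h b.
Proof. by move=> ga /funext <- <-. Qed.

Lemma is_derive_mul (g h : R -> R) t (a b : R) :
  is_derive t 1 g a -> is_derive t 1 h b ->
  is_derive t 1 (fun s => g s * h s) (a * h t + g t * b).
Proof.
move=> ga hb; have := is_deriveM ga hb; move/is_derive_congr; apply=> //.
by rewrite /GRing.scale/= addrC mulrC.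
Qed.

Lemma cderivM g h t a b : cderiv g t a -> cderiv h t b ->
  cderiv (fun s => g s * h s) t (a * h t + g t * b).
Proof.
move=> [gr gi] [hr hi]; split.
- under eq_fun do rewrite cReM.
  have := is_deriveB (is_derive_mul gr hr) (is_derive_mul gi hi).
  by move/is_derive_congr; apply=> //; rewrite cReD !cReM; ring.
- under eq_fun do rewrite cImM.
  have := is_deriveD (is_derive_mul gr hi) (is_derive_mul gi hr).
  by move/is_derive_congr; apply=> //; rewrite cImD !cImM; ring.
Qed.

Lemma cderivJ g t a :
  cderiv g t a -> cderiv (fun s => conjc (g s)) t (conjc a).
Proof.
move=> [gr gi]; split.
- under eq_fun do rewrite cReJ.
  by rewrite cReJ.
- under eq_fun do rewrite cImJ.
  by rewrite cImJ; exact: is_deriveN.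
Qed.

Lemma normc2_neq0 a : a != 0 -> Re a ^+ 2 + Im a ^+ 2 != 0.
Proof.
move=> a0; rewrite -normc_sqr sqrf_eq0; apply: contra a0 => /eqP.
by move/Normc.eq0_normc => ->.
Qed.

Lemma is_derive_div (g h : R -> R) t (a b : R) : h t != 0 ->
  is_derive t 1 g a -> is_derive t 1 h b ->
  is_derive t 1 (fun s => g s / h s) ((a * h t - g t * b) / h t ^+ 2).
Proof.
move=> h0 ga hb; have := is_derive_mul ga (is_deriveV h0 hb).
by move/is_derive_congr; apply=> //; rewrite /GRing.scale/=; field.
Qed.

Lemma cderivV g t a : g t != 0 ->
  cderiv g t a -> cderiv (fun s => (g s)^-1) t (- (a / g t ^+ 2)).
Proof.
move=> g0 [gr gi]; have n0 := normc2_neq0 g0.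
have eV : a / g t ^+ 2 = a * ((g t)^-1 * (g t)^-1) by rewrite expr2 invfM.
have dn := is_deriveD (is_derive_mul gr gr) (is_derive_mul gi gi).
split.
- under eq_fun do rewrite cReV.
  have := is_derive_div (h := fun s => Re (g s) ^+ 2 + Im (g s) ^+ 2) n0 gr dn.
  move/is_derive_congr; apply=> //; rewrite eV cReN !cReM !cImM cReV cImV.
  by field.
- under eq_fun do rewrite cImV.
  have := is_deriveN (is_derive_div (h := fun s => Re (g s) ^+ 2 + Im (g s) ^+ 2) n0 gi dn).
  move/is_derive_congr; apply=> //; rewrite eV cImN !(cReM, cImM) cReV cImV.
  by field.
Qed.

Lemma cderiv_line t a b : cderiv (fun s => a + s%:C * b) t b.
Proof.
have E := is_derive_mul (is_derive_id t 1) (is_derive_cst _ t 1).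
split.
- have -> : (fun s : R => Re (a + s%:C * b)) = (fun s => Re a + s * Re b).
    by apply/funext => s; rewrite cReD cReM/= mul0r subr0.
  have := is_deriveD (is_derive_cst (Re a) t 1) (E (Re b)).
  by move/is_derive_congr; apply=> //=; ring.
- have -> : (fun s : R => Im (a + s%:C * b)) = (fun s => Im a + s * Im b).
    by apply/funext => s; rewrite cImD cImM/= mul0r addr0.
  have := is_deriveD (is_derive_cst (Im a) t 1) (E (Im b)).
  by move/is_derive_congr; apply=> //=; ring.
Qed.

(** In the right half-plane a single branch of [carg] applies, which leaves a formula in [ln] and
    [atan] that can be differentiated directly. *)
Lemma clogE w : 0 < Re w ->
  clog w = (2^-1 * ln (Re w ^+ 2 + Im w ^+ 2)) +i* atan (Im w / Re w).
Proof.
case: w => x y /= x0; rewrite /clog /= x0; congr (_ +i* _).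
rewrite -powR12_sqrt ?addr_ge0 ?sqr_ge0// ln_powR//.
Qed.

Lemma is_derive_gt0_near (g : R -> R) t (a : R) :
  is_derive t 1 g a -> 0 < g t -> \near t, 0 < g t.
Proof.
move=> dg g0.
have cg : {for t, continuous g}.
  by apply: differentiable_continuous; apply/derivable1_diffP; exact: ex_derive.
exact: (cvgr_gt (g t) cg).
Qed.

Lemma cderiv_clog g t a : 0 < Re (g t) ->
  cderiv g t a -> cderiv (fun s => clog (g s)) t (a / g t).
Proof.
move=> g0 [gr gi].
have g1 : g t != 0 by apply/eqP => g1; move: g0; rewrite g1 ltxx.
have n0 := normc2_neq0 g1.
have np : 0 < Re (g t) ^+ 2 + Im (g t) ^+ 2.
  by rewrite lt_neqAle eq_sym n0 addr_ge0 ?sqr_ge0.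
apply: (@near_eq_cderiv (fun s => (2^-1 * ln (Re (g s) ^+ 2 + Im (g s) ^+ 2))
   +i* atan (Im (g s) / Re (g s)))).
  have := is_derive_gt0_near gr g0; apply: filterS => s s0.
  by rewrite clogE.
have dn := is_deriveD (is_derive_mul gr gr) (is_derive_mul gi gi).
split => /=.
- have dl := @is_derive1_comp R (@ln R) (fun s => Re (g s) ^+ 2 + Im (g s) ^+ 2)
    t _ _ (is_derive1_ln np) dn.
  have := is_derive_mul (is_derive_cst (2^-1 : R) t 1) dl.
  move/is_derive_congr; apply=> //=; rewrite cReM cReV cImV.
  by field.
- have dq := is_derive_div (lt0r_neq0 g0) gi gr.
  have := @is_derive1_comp R (@atan R) (fun s => Im (g s) / Re (g s))
    t _ _ (is_derive1_atan _) dq.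
  move/is_derive_congr; apply=> //=; rewrite cImM cReV cImV.
  have r0 := lt0r_neq0 g0.
  by field; rewrite n0 r0.
Qed.

Lemma cderiv_cexp g t a :
  cderiv g t a -> cderiv (fun s => cexp (g s)) t (cexp (g t) * a).
Proof.
move=> [gr gi].
have de := @is_derive1_comp R (@expR R) (fun s => Re (g s)) t _ _
  (is_derive_expR _) gr.
have dc := @is_derive1_comp R (@cos R) (fun s => Im (g s)) t _ _
  (is_derive_cos _) gi.
have ds := @is_derive1_comp R (@sin R) (fun s => Im (g s)) t _ _
  (is_derive_sin _) gi.
split.
- have -> : (fun s => Re (cexp (g s))) =
      (fun s => expR (Re (g s)) * cos (Im (g s))).
    by apply/funext => s; rewrite cReM/= mul0r subr0.
  have := is_derive_mul de dc; move/is_derive_congr; apply=> //=.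
  by rewrite !cReM !cImM/=; ring.
- have -> : (fun s => Im (cexp (g s))) =
      (fun s => expR (Re (g s)) * sin (Im (g s))).
    by apply/funext => s; rewrite cImM/= mul0r addr0.
  have := is_derive_mul de ds; move/is_derive_congr; apply=> //=.
  by rewrite !cImM !cReM/=; ring.
Qed.

Lemma cderiv_cpow g t a b : 0 < Re (g t) -> cderiv g t a ->
  cderiv (fun s => cpow (g s) b) t (cpow (g t) b * (b * (a / g t))).
Proof.
move=> g0 da; apply: cderiv_cexp; apply: cderiv_eq.
  exact: cderivM (cderiv_cst t b) (cderiv_clog g0 da).
by rewrite mul0r add0r.
Qed.

Lemma normc_cpow w b : 0 < Re w ->
  cabs (cpow w b) = cabs w `^ Re b * expR (- (Im b * carg w)).
Proof.
move=> w0.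
have ne (c : R[i]) : cabs (cexp c) = expR (Re c).
  rewrite /cexp Normc.normcM.
  by rewrite (eqP (cabs_expi _)) mulr1 /= expr0n addr0 sqrtr_sqr ger0_norm ?expR_ge0.
have wp : 0 < cabs w by apply: lt_le_trans w0 (le_trans (ler_norm _) (Re_le_normc _)).
by rewrite ne cReM/= expRD /powR gt_eqF.
Qed.

Lemma normc_carg w : 0 < Re w -> `|carg w| <= pi / 2.
Proof.
case: w => x y /= -> ; rewrite ler_norml.
by rewrite (ltW (atan_gtNpi2 _)) (ltW (atan_ltpi2 _)).
Qed.

End Curves.

(** * Wirtinger derivatives as real differentials *)

Section Wirtinger.
Variable R : realType.
Implicit Types (f g : R[i] -> R[i]) (z p q : R[i]).

(** The differential v -> p v + q conj(v), along all lines at once: p and q are the two Wirtinger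
    derivatives, and the pair obeys the product, quotient and chain rules without separating
    directions. *)
Definition wirtinger f z p q : Prop :=
  forall v, cderiv (fun t : R => f (z + t%:C * v)) 0 (p * v + q * conjc v).

Lemma line0 z (v : R[i]) : z + (0 : R)%:C * v = z.
Proof. by rewrite mul0r addr0. Qed.

Lemma wirtinger_eq f z p q p' q' :
  wirtinger f z p q -> p = p' -> q = q' -> wirtinger f z p' q'.
Proof. by move=> ? <- <-. Qed.

Lemma wirtinger_cst c z : wirtinger (fun=> c) z 0 0.
Proof. by move=> v; rewrite !mul0r addr0; exact: cderiv_cst. Qed.

Lemma wirtinger_id z : wirtinger id z 1 0.
Proof. by move=> v; rewrite mul1r mul0r addr0; exact: cderiv_line. Qed.

Lemma wirtinger_conjc z : wirtinger (fun w => conjc w) z 0 1.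
Proof.
by move=> v; rewrite mul1r mul0r add0r; apply: cderivJ; exact: cderiv_line.
Qed.

Lemma wirtingerD f g z p q p' q' : wirtinger f z p q -> wirtinger g z p' q' ->
  wirtinger (fun w => f w + g w) z (p + p') (q + q').
Proof.
move=> hf hg v; apply: cderiv_eq; first exact: cderivD (hf v) (hg v).
by ring.
Qed.

Lemma wirtingerM f g z p q p' q' : wirtinger f z p q -> wirtinger g z p' q' ->
  wirtinger (fun w => f w * g w) z (p * g z + f z * p') (q * g z + f z * q').
Proof.
move=> hf hg v; apply: cderiv_eq; first exact: cderivM (hf v) (hg v).
by cbv beta; rewrite !line0; ring.
Qed.

Lemma wirtingerV f z p q : f z != 0 -> wirtinger f z p q ->
  wirtinger (fun w => (f w)^-1) z (- (p / f z ^+ 2)) (- (q / f z ^+ 2)).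
Proof.
move=> f0 hf v; apply: cderiv_eq; first by apply: cderivV (hf v); cbv beta; rewrite line0.
by cbv beta; rewrite line0; ring.
Qed.

Lemma wirtinger_cpow f z p q b : 0 < Re (f z) -> wirtinger f z p q ->
  wirtinger (fun w => cpow (f w) b) z
    (cpow (f z) b * (b * (p / f z))) (cpow (f z) b * (b * (q / f z))).
Proof.
move=> f0 hf v; apply: cderiv_eq.
  by apply: cderiv_cpow (hf v); cbv beta; rewrite line0.
by cbv beta; rewrite line0; ring.
Qed.

Lemma cderiv_shift (g : R -> R[i]) t a :
  cderiv (fun s => g (t + s)) 0 a -> cderiv g t a.
Proof.
have shift (h : R -> R) (b : R) :
    is_derive (0 : R) 1 (fun s => h (t + s)) b -> is_derive t 1 h b.
  move=> dh.
  have d1 : is_derive t (1 : R) (fun s : R => s - t) 1.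
    have := is_deriveB (is_derive_id t (1 : R)) (is_derive_cst t t (1 : R)).
    by move/is_derive_congr; apply=> //; rewrite subr0.
  have dh' : is_derive (t - t) 1 (fun s : R => h (t + s)) b by rewrite subrr.
  have := @is_derive1_comp R (fun s => h (t + s)) (fun s => s - t) t _ _ dh' d1.
  by move/is_derive_congr; apply=> [s|]; rewrite ?mulr1//= addrC subrK.
by move=> [gr gi]; split; exact: shift.
Qed.

(** Restarting the line at z + t v gives the derivative at any parameter t, whereas [wirtinger]
    speaks of parameter 0 only; differentiation under the integral needs a whole interval of
    parameters. *)
Lemma wirtinger_line f z p q (v : R[i]) (t : R) :
  wirtinger f (z + t%:C * v) p q ->
  cderiv (fun s => f (z + s%:C * v)) t (p * v + q * conjc v).
Proof.
move=> /(_ v) hf; apply: cderiv_shift.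
have -> // : (fun s : R => f (z + (t + s)%:C * v)) =
  (fun s : R => f (z + t%:C * v + s%:C * v)).
by apply/funext => s; rewrite -addrA -mulrDl -rmorphD.
Qed.

End Wirtinger.

(** * The kernel and its derivatives *)

Section Kernel.
Variable R : realType.
Variables al be : R[i].
Implicit Types (z : R[i]) (s : circle R).

(** Writing |z|^2 as z conj(z) and distributing the conjugate makes each base a polynomial in z and
    conj(z), with evident Wirtinger derivatives. *)
Definition kA z : R[i] := 1 - z * conjc z.
Definition kB z s : R[i] := 1 - z * conjc (sval s).
Definition kD z s : R[i] := 1 - conjc z * sval s.

Definition ukernel z s : R[i] :=
  cpow (kA z) (al + be + 1) / (cpow (kB z s) (al + 1) * cpow (kD z s) (be + 1)).

Lemma normc_circle s : cabs (sval s) = 1.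
Proof. exact/eqP/(svalP s). Qed.

Lemma normc_conj z : cabs (conjc z) = cabs z.
Proof. by case: z => x y; rewrite /= sqrrN. Qed.

Lemma normc_sqrE z : (cabs z ^+ 2)%:C = z * conjc z.
Proof.
by apply: complex_ext; rewrite ?cReM ?cImM cReJ cImJ ?normc_sqr/=; ring.
Qed.

Lemma kAE z : kA z = (1 - cabs z ^+ 2)%:C.
Proof. by rewrite /kA -normc_sqrE rmorphB rmorph1. Qed.

Lemma kDE z s : kD z s = conjc (kB z s).
Proof.
by apply: complex_ext;
  rewrite ?(cReD, cImD, cReN, cImN, cReM, cImM, cReJ, cImJ)/=; ring.
Qed.

Lemma u_kernelE z s : u_kernel al be (z * conjc (sval s)) = ukernel z s.
Proof.
rewrite /u_kernel /ukernel kDE kAE Normc.normcM normc_conj normc_circle mulr1.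
have -> : 1 - (cabs z ^+ 2)%:C = (1 - cabs z ^+ 2)%:C by rewrite rmorphB rmorph1.
suff -> : 1 - conjc (z * conjc (sval s)) = conjc (kB z s) by [].
by rewrite /kB; case: (z * _) => x y; apply: complex_ext => /=; ring.
Qed.

Lemma one_sub_sqr_gt0 z : cabs z < 1 -> 0 < 1 - cabs z ^+ 2.
Proof. by move=> z1; have := normc_ge0 z; nra. Qed.

Lemma Re_kA z : cabs z < 1 -> 0 < Re (kA z).
Proof. by move=> z1; rewrite kAE one_sub_sqr_gt0. Qed.

Lemma Re_kB z s : cabs z < 1 -> 0 < Re (kB z s).
Proof.
move=> z1; rewrite cReD cReN subr_gt0; apply: le_lt_trans z1.
apply: le_trans (ler_norm _) (le_trans (Re_le_normc _) _).
by rewrite Normc.normcM normc_conj normc_circle mulr1.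
Qed.

Lemma Re_kD z s : cabs z < 1 -> 0 < Re (kD z s).
Proof. by move=> z1; rewrite kDE cReJ Re_kB. Qed.

Lemma Re_gt0_neq0 (w : R[i]) : 0 < Re w -> w != 0.
Proof. by apply: contraPneq => ->; rewrite ltxx. Qed.

Lemma wirtinger_kA z : wirtinger kA z (- conjc z) (- z).
Proof.
have h1 := wirtingerM (wirtinger_id z) (wirtinger_conjc z).
have h2 := wirtingerM (wirtinger_cst (-1) z) h1.
have := wirtingerD (wirtinger_cst 1 z) h2.
rewrite (_ : (fun _ => _) = kA); last by apply/funext => w; rewrite /kA mulN1r.
by move/wirtinger_eq; apply; ring.
Qed.

Lemma wirtinger_kB s z : wirtinger (kB^~ s) z (- conjc (sval s)) 0.
Proof.
have h2 := wirtingerM (wirtinger_id z) (wirtinger_cst (- conjc (sval s)) z).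
have := wirtingerD (wirtinger_cst 1 z) h2.
rewrite (_ : (fun _ => _) = kB^~ s); last first.
  by apply/funext => w; rewrite /kB mulrN.
by move/wirtinger_eq; apply; ring.
Qed.

Lemma wirtinger_kD s z : wirtinger (kD^~ s) z 0 (- sval s).
Proof.
have h2 := wirtingerM (wirtinger_conjc z) (wirtinger_cst (- sval s) z).
have := wirtingerD (wirtinger_cst 1 z) h2.
rewrite (_ : (fun _ => _) = kD^~ s); last first.
  by apply/funext => w; rewrite /kD mulrN.
by move/wirtinger_eq; apply; ring.
Qed.

Lemma cpow_neq0 (w b : R[i]) : cpow w b != 0.
Proof.
rewrite mulf_neq0//.
  by apply/eqP => -[]; apply/eqP; rewrite gt_eqF ?expR_gt0.
apply/eqP => -[c0 s0]; have := cos2Dsin2 (Im (b * clog w)).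
by rewrite c0 s0 !expr0n addr0 => /eqP; rewrite eq_sym oner_eq0.
Qed.

Lemma wirtinger_ukernel z s : cabs z < 1 ->
  wirtinger (ukernel^~ s) z
   (ukernel z s * (- (al + be + 1) * conjc z / kA z + (al + 1) * conjc (sval s) / kB z s))
   (ukernel z s * (- (al + be + 1) * z / kA z + (be + 1) * sval s / kD z s)).
Proof.
move=> z1.
have hA := @wirtinger_cpow _ kA _ _ _ (al + be + 1) (Re_kA z1) (wirtinger_kA z).
have hB := @wirtinger_cpow _ (kB^~ s) _ _ _ (al + 1) (Re_kB s z1) (wirtinger_kB s z).
have hD := @wirtinger_cpow _ (kD^~ s) _ _ _ (be + 1) (Re_kD s z1) (wirtinger_kD s z).
have BD0 : cpow (kB z s) (al + 1) * cpow (kD z s) (be + 1) != 0.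
  by rewrite mulf_neq0// cpow_neq0.
have A0 := Re_gt0_neq0 (Re_kA z1).
have B0 := Re_gt0_neq0 (Re_kB s z1).
have D0 := Re_gt0_neq0 (Re_kD s z1).
have := wirtingerM hA (@wirtingerV _
  (fun w => cpow (kB w s) (al + 1) * cpow (kD w s) (be + 1))
  _ _ _ BD0 (wirtingerM hB hD)).
have pB := cpow_neq0 (kB z s) (al + 1).
have pD := cpow_neq0 (kD z s) (be + 1).
by move/wirtinger_eq; apply; rewrite /ukernel; field; rewrite ?A0 ?B0 ?D0 ?pB ?pD.
Qed.

(** Only factors 1/A, 1/B, 1/D are counted, since z and s are bounded by 1. [rat_lift] makes the
    index an upper bound for the weight, so that lower terms, such as the derivative of a constant,
    fit as well. *)
Inductive rat_ker : nat -> (R[i] -> circle R -> R[i]) -> Prop :=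
| rat_cst c : rat_ker 0 (fun _ _ => c)
| rat_z : rat_ker 0 (fun z _ => z)
| rat_zbar : rat_ker 0 (fun z _ => conjc z)
| rat_s : rat_ker 0 (fun _ s => sval s)
| rat_sbar : rat_ker 0 (fun _ s => conjc (sval s))
| rat_VA : rat_ker 1 (fun z _ => (kA z)^-1)
| rat_VB : rat_ker 1 (fun z s => (kB z s)^-1)
| rat_VD : rat_ker 1 (fun z s => (kD z s)^-1)
| rat_add n f g : rat_ker n f -> rat_ker n g ->
    rat_ker n (fun z s => f z s + g z s)
| rat_mul m n f g : rat_ker m f -> rat_ker n g ->
    rat_ker (m + n) (fun z s => f z s * g z s)
| rat_lift n f : rat_ker n f -> rat_ker n.+1 f.

Lemma rat_eq m n f g : rat_ker m f -> m = n -> (forall z s, f z s = g z s) ->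
  rat_ker n g.
Proof.
by move=> fm <- fg; rewrite (_ : g = f)//; apply/funext => z; apply/funext.
Qed.

(** The factor U lets one predicate cover the derivatives of a rational function (U = 1) and those
    of the kernel times one, where U is carried along. *)
Definition has_rat_wirtinger n (U f : R[i] -> circle R -> R[i]) : Prop :=
  exists p q, [/\ rat_ker n p, rat_ker n q & forall z s, cabs z < 1 ->
    wirtinger (f^~ s) z (U z s * p z s) (U z s * q z s)].

Lemma rat_ker_wirtinger n f :
  rat_ker n f -> has_rat_wirtinger n.+1 (fun _ _ => 1) f.
Proof.
have r0 : rat_ker 1 (fun _ _ => 0) by apply: rat_lift; exact: rat_cst.
have r1 : rat_ker 1 (fun _ _ => 1) by apply: rat_lift; exact: rat_cst.
rewrite /has_rat_wirtinger.
have simp (g : R[i] -> circle R -> R[i]) m (p q : R[i] -> circle R -> R[i]) :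
    rat_ker m p -> rat_ker m q ->
    (forall z s, cabs z < 1 -> wirtinger (g^~ s) z (p z s) (q z s)) ->
    exists p q, [/\ rat_ker m p, rat_ker m q & forall z s, cabs z < 1 ->
      wirtinger (g^~ s) z (1 * p z s) (1 * q z s)].
  by move=> hp hq hg; exists p, q; split=> // z s z1; rewrite !mul1r; exact: hg.
elim: f / => [c|||||||| m f g _ [p [q [hp hq hf]]] _ [p' [q' [hp' hq' hg]]]
  | m m' f g rf [p [q [hp hq hf]]] rg [p' [q' [hp' hq' hg]]]
  | m f _ [p [q [hp hq hf]]]].
- by apply: (simp _ _ _ _ r0 r0) => z s _; exact: wirtinger_cst.
- by apply: (simp _ _ _ _ r1 r0) => z s _; exact: wirtinger_id.
- by apply: (simp _ _ _ _ r0 r1) => z s _; exact: wirtinger_conjc.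
- by apply: (simp _ _ _ _ r0 r0) => z s _; exact: wirtinger_cst.
- by apply: (simp _ _ _ _ r0 r0) => z s _; exact: wirtinger_cst.
- apply: (simp _ _ (fun z _ => conjc z * ((kA z)^-1 * (kA z)^-1))
      (fun z _ => z * ((kA z)^-1 * (kA z)^-1))).
  + exact: rat_mul rat_zbar (rat_mul rat_VA rat_VA).
  + exact: rat_mul rat_z (rat_mul rat_VA rat_VA).
  + move=> z s z1; have := @wirtingerV _ kA _ _ _ (Re_gt0_neq0 (Re_kA z1)) (wirtinger_kA z).
    by move/wirtinger_eq; apply; rewrite expr2 invfM; ring.
- apply: (simp _ _ (fun z s => conjc (sval s) * ((kB z s)^-1 * (kB z s)^-1))
      (fun z _ => 0)).
  + exact: rat_mul rat_sbar (rat_mul rat_VB rat_VB).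
  + exact: rat_lift.
  + move=> z s z1; have := @wirtingerV _ (kB^~ s) _ _ _ (Re_gt0_neq0 (Re_kB s z1)) (wirtinger_kB s z).
    by move/wirtinger_eq; apply; rewrite expr2 invfM; ring.
- apply: (simp _ _ (fun z _ => 0)
    (fun z s => sval s * ((kD z s)^-1 * (kD z s)^-1))).
  + exact: rat_lift.
  + exact: rat_mul rat_s (rat_mul rat_VD rat_VD).
  + move=> z s z1; have := @wirtingerV _ (kD^~ s) _ _ _ (Re_gt0_neq0 (Re_kD s z1)) (wirtinger_kD s z).
    by move/wirtinger_eq; apply; rewrite expr2 invfM; ring.
- exists (fun z s => p z s + p' z s), (fun z s => q z s + q' z s).
  split; [exact: rat_add|exact: rat_add|move=> z s z1].
  have := wirtingerD (hf _ s z1) (hg _ s z1).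
  by move/wirtinger_eq; apply; ring.
- exists (fun z s => p z s * g z s + f z s * p' z s),
    (fun z s => q z s * g z s + f z s * q' z s).
  split.
  + apply: rat_add; first exact: rat_mul hp rg.
    by apply: rat_eq (rat_mul rf hp') _ _ => //; rewrite addnS.
  + apply: rat_add; first exact: rat_mul hq rg.
    by apply: rat_eq (rat_mul rf hq') _ _ => //; rewrite addnS.
  + move=> z s z1; have := wirtingerM (hf _ s z1) (hg _ s z1).
    by move/wirtinger_eq; apply; ring.
- by exists p, q; split => //; exact: rat_lift.
Qed.

(** Leibniz rule: [a] and [b] below are the logarithmic derivatives of the kernel, of weight 1, so
    the new factors are a f + p and b f + q and the weight grows by one. *)
Lemma ukernel_wirtinger n f :
  rat_ker n f -> has_rat_wirtinger n.+1 ukernel (fun z s => ukernel z s * f z s).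
Proof.
move=> rf; have [p [q [rp rq hf]]] := rat_ker_wirtinger rf.
pose a z s := - (al + be + 1) * (conjc z * (kA z)^-1) +
  (al + 1) * (conjc (sval s) * (kB z s)^-1).
pose b z s := - (al + be + 1) * (z * (kA z)^-1) +
  (be + 1) * (sval s * (kD z s)^-1).
have ra : rat_ker 1 a.
  apply: rat_add; apply: (rat_mul (rat_cst _)).
    exact: rat_mul rat_zbar rat_VA.
  exact: rat_mul rat_sbar rat_VB.
have rb : rat_ker 1 b.
  apply: rat_add; apply: (rat_mul (rat_cst _)).
    exact: rat_mul rat_z rat_VA.
  exact: rat_mul rat_s rat_VD.
exists (fun z s => a z s * f z s + p z s), (fun z s => b z s * f z s + q z s).
split; [exact: rat_add (rat_mul ra rf) rp|exact: rat_add (rat_mul rb rf) rq|].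
move=> z s z1; have := wirtingerM (wirtinger_ukernel s z1) (hf _ s z1).
by move/wirtinger_eq; apply; rewrite /a /b; ring.
Qed.

End Kernel.

(** * Pointwise bounds on the kernel and on rational factors *)

Section KernelBounds.
Variable R : realType.
Variables al be : R[i].
Implicit Types (z : R[i]) (s : circle R).

Local Notation gap z := (1 - cabs z ^+ 2).

(** The triangle inequality gives 1 - |z|, and 1 + |z| <= 2. *)
Lemma kB_ge z s : cabs z < 1 -> gap z / 2 <= cabs (kB z s).
Proof.
move=> z1; have z0 := normc_ge0 z.
have : cabs (1 : R[i]) <= cabs (kB z s) + cabs (z * conjc (sval s)).
  by apply: le_trans (le_normcD _ _); rewrite /kB subrK.
rewrite Normc.normc1 Normc.normcM normc_conj normc_circle mulr1; nra.
Qed.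

Lemma kB_gt0 z s : cabs z < 1 -> 0 < cabs (kB z s).
Proof.
by move=> z1; apply: lt_le_trans (kB_ge s z1); rewrite divr_gt0// one_sub_sqr_gt0.
Qed.

Lemma normc_kA z : cabs z < 1 -> cabs (kA z) = gap z.
Proof.
by move=> z1; rewrite kAE /= expr0n addr0 sqrtr_sqr gtr0_norm// one_sub_sqr_gt0.
Qed.

Lemma rat_ker_bound n f : rat_ker n f ->
  exists2 C : R, 0 <= C & forall z s, cabs z < 1 ->
    cabs (f z s) <= C / gap z ^+ n.
Proof.
have VB z s : cabs z < 1 -> cabs (kB z s)^-1 <= 2 / gap z ^+ 1.
  move=> z1; rewrite Normc.normcV expr1 -[leRHS]invrK invf_div.
  by rewrite lef_pV2 ?posrE ?kB_gt0 ?kB_ge ?divr_gt0 ?one_sub_sqr_gt0.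
have cst0 c (x : R) : c <= x -> c <= x / 1 by rewrite divr1.
elim: f / => [c|||||||| m f g _ [C C0 hC] _ [C' C'0 hC']
  | m m' f g _ [C C0 hC] _ [C' C'0 hC'] | m f _ [C C0 hC]].
- by exists (cabs c); [exact: normc_ge0|move=> z s _; exact: cst0].
- by exists 1 => // z s z1; apply: cst0; exact: ltW.
- by exists 1 => // z s z1; apply: cst0; rewrite normc_conj ltW.
- by exists 1 => // z s z1; apply: cst0; rewrite normc_circle.
- by exists 1 => // z s z1; apply: cst0; rewrite normc_conj normc_circle.
- by exists 1 => // z s z1; rewrite Normc.normcV normc_kA// div1r.
- by exists 2 => // z s z1; exact: VB.
- exists 2 => // z s z1; rewrite kDE.
  by rewrite Normc.normcV normc_conj -Normc.normcV; exact: VB.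
- exists (C + C') => [|z s z1]; first exact: addr_ge0.
  by rewrite mulrDl (le_trans (le_normcD _ _))// lerD ?hC ?hC'.
- exists (C * C') => [|z s z1]; first exact: mulr_ge0.
  rewrite Normc.normcM exprD invfM mulrACA.
  by rewrite ler_pM ?normc_ge0 ?hC ?hC'.
(* Raising the weight is harmless because 0 < A <= 1. *)
- exists C => // z s z1; have g0 := one_sub_sqr_gt0 z1.
  apply: le_trans (hC _ _ z1) _; rewrite ler_wpM2l// lef_pV2 ?posrE ?exprn_gt0//.
  by rewrite exprS ler_piMl ?exprn_ge0 ?(ltW g0)// lerBlDr lerDl sqr_ge0.
Qed.

Definition majorant (sg : R) z s : R := gap z `^ sg / cabs (kB z s) `^ (sg + 1).

Lemma majorant_ge0 sg z s : 0 <= majorant sg z s.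
Proof. by rewrite divr_ge0 ?powR_ge0. Qed.

Lemma majorant_le sg z s : 0 <= sg -> cabs z < 1 -> majorant sg z s <= 2 `^ (sg + 1) / gap z.
Proof.
move=> sg0 z1; have g0 := one_sub_sqr_gt0 z1.
rewrite /majorant ler_pdivrMr ?powR_gt0 ?kB_gt0//.
have : (gap z / 2) `^ (sg + 1) <= cabs (kB z s) `^ (sg + 1).
  by apply: ge0_ler_powR; rewrite ?nnegrE ?kB_ge ?normc_ge0 ?divr_ge0 ?(ltW g0) ?addr_ge0.
move=> /(ler_wpM2l (powR_ge0 2 (sg + 1))).
rewrite -powRM ?divr_ge0 ?(ltW g0)// mulrCA divff// mulr1.
rewrite [X in X <= _]powRD ?(gt_eqF g0) ?implybT// powRr1 ?(ltW g0)// => h.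
by rewrite mulrAC ler_pdivlMr.
Qed.

(** The modulus of w^b is |w|^(Re b) exp(-Im b arg w). A is positive, so its argument vanishes, and
    |D| = |B| merges two real exponents into sg + 1. *)
Lemma ukernel_bound : exists2 C : R, 0 <= C & forall z s, cabs z < 1 ->
  cabs (ukernel al be z s) <= C * majorant (Re al + Re be + 1) z s.
Proof.
(* [Im al + 0] is Im(al + 1) in the form left by expansion; pi / 2 bounds the arguments of B and
   D. *)
exists (expR (`|Im al + 0| * (pi / 2)) * expR (`|Im be + 0| * (pi / 2))).
  by rewrite mulr_ge0 ?expR_ge0.
move=> z s z1; have b0 := kB_gt0 s z1.
have argB b (w : R[i]) : 0 < Re w -> expR (b * carg w) <= expR (`|b| * (pi / 2)).
  move=> w0; rewrite ler_expR (le_trans (ler_norm _))// normrM.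
  by rewrite ler_wpM2l// normc_carg.
have normc_quot (a b c : R[i]) : cabs (a / (b * c)) = cabs a / (cabs b * cabs c).
  by rewrite Normc.normcM Normc.normcV Normc.normcM.
rewrite /ukernel normc_quot normc_cpow ?Re_kA// normc_cpow ?Re_kB// normc_cpow ?Re_kD//.
have -> : cabs (kD z s) = cabs (kB z s) by rewrite kDE normc_conj.
rewrite normc_kA//.
have -> : carg (kA z) = 0.
  by rewrite kAE /= one_sub_sqr_gt0// mul0r atan0.
rewrite mulr0 oppr0 expR0 mulr1 !cReD !cImD.
rewrite [Re 1]/= [Im 1]/= /majorant !invfM -!expRN !opprK.
have -> : Re al + Re be + 1 + 1 = (Re al + 1) + (Re be + 1) by ring.
rewrite [X in _ <= _ * (_ / X)]powRD ?(gt_eqF b0) ?implybT// invfM.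
set p := _ `^ _; set q := (_ `^ (Re al + 1))^-1; set r := (_ `^ (Re be + 1))^-1.
set x := expR ((Im al + _) * _); set y := expR ((Im be + _) * _).
have -> : p * (q * x * (r * y)) = (x * y) * (p * (q * r)) by ring.
rewrite ler_wpM2r// ?mulr_ge0 ?invr_ge0 ?powR_ge0//.
by rewrite ler_pM ?expR_ge0// argB ?Re_kB ?Re_kD.
Qed.

End KernelBounds.

(** * Measurability on the circle *)

Section KernelMeasurability.
Variable R : realType.
Local Notation T := (borel_circle R).
Implicit Types (f g : T -> R[i]) (h : T -> R).

Definition cmeas f : Prop :=
  measurable_fun [set: T] (fun s => Re (f s)) /\
  measurable_fun [set: T] (fun s => Im (f s)).

Lemma cmeas_cst c : cmeas (fun=> c).
Proof. by split; exact: measurable_cst. Qed.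

Lemma cmeasD f g : cmeas f -> cmeas g -> cmeas (fun s => f s + g s).
Proof.
move=> [fr fi] [gr gi]; split.
- by under eq_fun do rewrite cReD; exact: measurable_funD.
- by under eq_fun do rewrite cImD; exact: measurable_funD.
Qed.

Lemma cmeasM f g : cmeas f -> cmeas g -> cmeas (fun s => f s * g s).
Proof.
move=> [fr fi] [gr gi]; split.
- by under eq_fun do rewrite cReM; apply: measurable_funB; exact: measurable_funM.
- by under eq_fun do rewrite cImM; apply: measurable_funD; exact: measurable_funM.
Qed.

Lemma cmeasJ f : cmeas f -> cmeas (fun s => conjc (f s)).
Proof.
move=> [fr fi]; split.
- by under eq_fun do rewrite cReJ.
- by under eq_fun do rewrite cImJ; exact: measurableT_comp.
Qed.

(** The identity 1/h = h (h^2)^(-1) reduces the claim to real powers; at a zero of h both sides are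
    0, since 1/0 = 0. *)
Lemma measurable_inv h : measurable_fun [set: T] h ->
  measurable_fun [set: T] (fun s => (h s)^-1).
Proof.
move=> mh.
have -> : (fun s => (h s)^-1) = (fun s => h s * (h s * h s) `^ (-1)).
  apply/funext => s; rewrite powR_inv1 ?sqr_ge0// invfM mulrA.
  have [->|h0] := eqVneq (h s) 0; first by rewrite invr0 !mulr0.
  by rewrite divff// mul1r.
apply: measurable_funM => //; apply: (measurableT_comp (measurable_powR _)).
exact: measurable_funM.
Qed.

Lemma cmeasV f : cmeas f -> cmeas (fun s => (f s)^-1).
Proof.
move=> [fr fi].
have mn : measurable_fun [set: T] (fun s => (Re (f s) ^+ 2 + Im (f s) ^+ 2)^-1).
  by apply: measurable_inv; apply: measurable_funD; exact: measurable_funX.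
split.
- by under eq_fun do rewrite cReV; exact: measurable_funM.
- under eq_fun do rewrite cImV.
  by apply: measurableT_comp => //; exact: measurable_funM.
Qed.

Lemma cmeas_cpow f b : (forall s, 0 < Re (f s)) -> cmeas f ->
  cmeas (fun s => cpow (f s) b).
Proof.
move=> f0 [fr fi].
have ml : cmeas (fun s => b * clog (f s)).
  apply: cmeasM; first exact: cmeas_cst.
  split.
  - under eq_fun do rewrite clogE//=.
    apply: measurable_funM => //; apply: (measurableT_comp (@measurable_ln R)).
    by apply: measurable_funD; exact: measurable_funX.
  - under eq_fun do rewrite clogE//=.
    apply: (measurableT_comp (continuous_measurable_fun (@continuous_atan R))).
    by apply: measurable_funM => //; exact: measurable_inv.
case: ml => lr li.
apply: cmeasM; first by split => //=; exact: (measurableT_comp (@measurable_expR R)).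
split => /=.
- exact: (measurableT_comp (continuous_measurable_fun (@continuous_cos R))).
- exact: (measurableT_comp (continuous_measurable_fun (@continuous_sin R))).
Qed.

(** A Lipschitz function pulls open intervals back to open sets of the plane, whose traces on the
    circle generate the sigma-algebra. *)
Lemma measurable_circle (h : R[i] -> R) :
  (forall z w, `|h z - h w| <= cabs (z - w)) ->
  measurable_fun [set: T] (fun s : circle R => h (sval s)).
Proof.
move=> hlip.
apply: (measurability _ (RGenOpens.measurableE R)) => //.
move=> _ [_ [a [b ->]] <-]; rewrite setTI; apply: sub_sigma_algebra.
exists [set z : R[i] | h z \in `]a, b[]; last by apply/seteqP; split=> s.
rewrite openE /= => z hz; rewrite /interior /= -nbhs_ballE.
have [e e0 he] := near_in_itvoo hz.
exists e%:C; first by rewrite /= ltcR.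
move=> w; rewrite /ball /= => zw; apply: he; rewrite /ball /=.
apply: le_lt_trans (hlip _ _) _; move: zw.
by rewrite normc_def ltcR /Normc.normc; case: (z - w).
Qed.

Lemma cmeas_sval : cmeas (fun s : circle R => sval s).
Proof.
split; apply: measurable_circle => z w.
- by rewrite -cReN -cReD Re_le_normc.
- by rewrite -cImN -cImD Im_le_normc.
Qed.

Lemma cmeas_normc f : cmeas f -> measurable_fun [set: T] (fun s => cabs (f s)).
Proof.
move=> [fr fi].
have -> : (fun s => cabs (f s)) =
    (fun s => (Re (f s) ^+ 2 + Im (f s) ^+ 2) `^ 2^-1).
  apply/funext => s; rewrite -normc_sqr -powR_mulrn ?normc_ge0// -powRrM.
  by rewrite mulfV// powRr1// normc_ge0.
apply: (measurableT_comp (measurable_powR _)).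
by apply: measurable_funD; exact: measurable_funX.
Qed.

Lemma cmeas_kB z : cmeas (kB z).
Proof.
have h : cmeas (fun s : T => - z * conjc (sval s)).
  exact: cmeasM (cmeas_cst _) (cmeasJ cmeas_sval).
have := cmeasD (cmeas_cst 1) h.
rewrite (_ : (fun _ => _) = kB z)//.
by apply/funext => s; rewrite mulNr.
Qed.

Lemma cmeas_kD z : cmeas (kD z).
Proof.
have := cmeasJ (cmeas_kB z).
by rewrite (_ : (fun _ => _) = kD z)//; apply/funext => s; rewrite kDE.
Qed.

Lemma cmeas_ukernel al be z : cabs z < 1 -> cmeas (ukernel al be z).
Proof.
move=> z1; apply: cmeasM; first exact: cmeas_cst.
apply: cmeasV; apply: cmeasM; apply: cmeas_cpow.
- by move=> s; exact: Re_kB.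
- exact: cmeas_kB.
- by move=> s; exact: Re_kD.
- exact: cmeas_kD.
Qed.

Lemma rat_ker_cmeas n (f : R[i] -> circle R -> R[i]) z :
  rat_ker n f -> cmeas (f z).
Proof.
elim: f / => [c|||||||| m f g _ hf _ hg | m m' f g _ hf _ hg | m f _ hf //].
- exact: cmeas_cst.
- exact: cmeas_cst.
- exact: cmeas_cst.
- exact: cmeas_sval.
- by apply: cmeasJ; exact: cmeas_sval.
- exact: cmeas_cst.
- by apply: cmeasV; exact: cmeas_kB.
- by apply: cmeasV; exact: cmeas_kD.
- exact: cmeasD.
- exact: cmeasM.
Qed.

Lemma measurable_majorant sg z : measurable_fun [set: T] (majorant sg z).
Proof.
apply: measurable_funM => //; apply: measurable_inv.
apply: (measurableT_comp (measurable_powR _)); apply: cmeas_normc.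
exact: cmeas_kB.
Qed.

End KernelMeasurability.

(** * The integral of the majorant over the circle *)

Section CircleKernelIntegral.
Variable R : realType.
Implicit Types (sg d c x r th : R).

Local Notation mu := (@lebesgue_measure R).

(** On x >= c this is the density of a Pareto law of scale d and exponent sg: minus the derivative
    of (d / (d + x - c))^sg. Its mass 1 is independent of d. *)
Definition tail_ker sg d c x : R := sg * d `^ sg * (d + (x - c)) `^ (- (sg + 1)).

Lemma is_derive_tail sg d c x : 0 < d -> c <= x ->
  is_derive x 1 (fun y => - (d `^ sg * (d + (y - c)) `^ (- sg))) (tail_ker sg d c x).
Proof.
move=> d0 cx; have dx : 0 < d + (x - c) by lra.
have d1 : is_derive x (1 : R) (fun y : R => d + (y - c)) 1.
  apply: (is_derive_congr
    (is_deriveD (is_derive_cst (d - c) x (1 : R)) (is_derive_id x (1 : R)))).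
    by move=> y; change (d - c + y = d + (y - c)); ring.
  exact: add0r.
have d2 := @is_derive1_comp R (fun y => y `^ (- sg)) (fun y => d + (y - c)) x _ _
  (is_derive1_powR (- sg) dx) d1.
have := is_deriveN (is_derive_mul (is_derive_cst (d `^ sg) x (1 : R)) d2).
move/is_derive_congr; apply=> //=.
by rewrite /tail_ker [- (sg + 1)]opprD; ring.
Qed.

Lemma cvg_tail sg d c : 0 < sg -> 0 < d ->
  - (d `^ sg * (d + (x - c)) `^ (- sg)) @[x --> +oo] --> (0 : R).
Proof.
move=> sg0 d0.
have h : (d + (x - c)) `^ (- sg) @[x --> +oo] --> (0 : R).
  apply/cvgrPdist_le => e e0.
  (* Writing e as Y^(-sg) turns the estimate into the comparison Y <= d + (x - c). *)
  have [Y Y0 ->] : exists2 Y, 0 < Y & e = Y `^ (- sg).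
    exists (e `^ (- sg^-1)); first by rewrite powR_gt0.
    by rewrite -powRrM mulrNN mulVf ?gt_eqF// powRr1// ltW.
  near=> x; rewrite sub0r normrN ger0_norm ?powR_ge0//.
  have Yx : Y <= d + (x - c).
    have : Y - d + c <= x.
      by near: x; apply: nbhs_pinfty_ge; exact: num_real.
    by lra.
  have dx := lt_le_trans Y0 Yx.
  rewrite !powRN lef_pV2 ?posrE ?powR_gt0//.
  by apply: (ge0_ler_powR (ltW sg0)) Yx; rewrite nnegrE ltW.
rewrite -[X in _ --> X]oppr0 -(mulr0 (d `^ sg)).
by apply: cvgN; apply: cvgM => //; exact: cvg_cst.
Unshelve. all: by end_near. Qed.

Lemma continuous_derivable (f : R -> R) x a : is_derive x 1 f a -> {for x, continuous f}.
Proof.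
move=> df; apply: differentiable_continuous; apply/derivable1_diffP.
exact: ex_derive.
Qed.

(** Up to a constant factor this kernel is the primitive belonging to the exponent sg + 1, hence
    derivable. *)
Lemma continuous_tail_ker sg d c x : 0 < d -> c <= x ->
  {for x, continuous (tail_ker sg d c)}.
Proof.
move=> d0 cx.
have := is_derive_tail (sg + 1) d0 cx; move/continuous_derivable.
move=> /(@cvgM _ _ _ _ _ _ _ _ (cvg_cst (- (sg * d `^ sg / d `^ (sg + 1))))).
have d1 : d `^ (sg + 1) != 0 by rewrite gt_eqF// powR_gt0.
have E y : - (sg * d `^ sg / d `^ (sg + 1)) *
    - (d `^ (sg + 1) * (d + (y - c)) `^ (- (sg + 1))) = tail_ker sg d c y.
  by rewrite /tail_ker; field.
rewrite /prop_for /continuous_at /= => h.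
rewrite -(E x); apply: cvg_trans h; apply: near_eq_cvg; apply: nearW => y.
by rewrite -E.
Qed.

Lemma integral_tail_ker sg d c : 0 < sg -> 0 < d ->
  (\int[mu]_(x in `[c, +oo[) (tail_ker sg d c x)%:E = 1)%E.
Proof.
move=> sg0 d0.
rewrite (@ge0_continuous_FTC2y _ _
  (fun y => - (d `^ sg * (d + (y - c)) `^ (- sg))) _ 0).
- rewrite subrr addr0 -powRD ?subrr ?eqxx ?gt_eqF// powRr0 sub0e.
  by rewrite -EFinN opprK.
- by move=> x cx; rewrite /tail_ker !mulr_ge0 ?powR_ge0// ltW.
- apply: continuous_in_subspaceT => x; rewrite inE/= in_itv/= andbT => cx.
  exact: continuous_tail_ker.
- exact: cvg_tail.
- by move=> x cx; have := is_derive_tail sg d0 (ltW cx) => ?; exact: ex_derive.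
- apply: cvg_at_right_filter.
  exact: (continuous_derivable (is_derive_tail sg d0 (lexx c))).
- move=> x; rewrite in_itv/= andbT => cx; rewrite derive1E.
  by have dt := is_derive_tail sg d0 (ltW cx); exact: derive_val.
Qed.

Definition sym_ker sg d c x : R := sg * d `^ sg * (d + `|x - c|) `^ (- (sg + 1)).

Lemma sym_ker_ge0 sg d c x : 0 <= sg -> 0 <= sym_ker sg d c x.
Proof. by move=> sg0; rewrite /sym_ker !mulr_ge0 ?powR_ge0. Qed.

Lemma measurable_sym_ker sg d c : measurable_fun setT (sym_ker sg d c).
Proof.
apply: measurable_funM => //; apply: (measurableT_comp (measurable_powR _)).
apply: measurable_funD => //; apply: measurableT_comp => //.
exact: measurable_funB.
Qed.

(** Each half-line carries mass 1, the left one after the reflection x -> -x; the inequality allows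
    enlarging ]c, +oo[ by its endpoint. *)
Lemma integral_sym_ker sg d c : 0 < sg -> 0 < d ->
  (\int[mu]_x (sym_ker sg d c x)%:E <= 2%:E)%E.
Proof.
move=> sg0 d0.
have mE : measurable_fun setT (EFin \o sym_ker sg d c).
  apply/measurable_EFinP; exact: measurable_sym_ker.
have s0 x : (0 <= (sym_ker sg d c x)%:E)%E by rewrite lee_fin sym_ker_ge0// ltW.
have right : (\int[mu]_(x in `[c, +oo[) (sym_ker sg d c x)%:E = 1)%E.
  rewrite -(integral_tail_ker c sg0 d0); apply: eq_integral => x.
  rewrite inE/= in_itv/= andbT => cx.
  by rewrite /sym_ker ger0_norm ?subr_ge0.
have left : (\int[mu]_(x in `]-oo, c]) (sym_ker sg d c x)%:E = 1)%E.
  rewrite -(integral_tail_ker (- c) sg0 d0).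
  have eL : (\int[mu]_(x in `]-oo, c]) (sym_ker sg d c x)%:E =
      \int[mu]_(x in `]-oo, c]) (tail_ker sg d (- c) (- x))%:E)%E.
    apply: eq_integral => x; rewrite inE/= in_itv/= => cx.
    by rewrite /sym_ker /tail_ker ler0_norm ?subr_le0// opprB opprK [c - x]addrC.
  rewrite eL.
  have := @ge0_integration_by_substitutionNy R (tail_ker sg d (- c) \o -%R) (- c).
  rewrite opprK => ->.
  - by apply: eq_integral => x _ /=; rewrite opprK.
  - apply: continuous_in_subspaceT => x; rewrite inE/= in_itv/= => cx.
    apply: continuous_comp; first exact: opp_continuous.
    by apply: continuous_tail_ker => //; rewrite lerN2.
  - move=> x; rewrite in_itv/= => cx.
    by rewrite /tail_ker !mulr_ge0 ?powR_ge0// ltW.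
have -> : [set: R] = `]-oo, c] `|` `]c, +oo[.
  apply/seteqP; split=> x //= _; rewrite !in_itv/= andbT.
  by case: (lerP x c); [left|right].
rewrite ge0_integral_setU//=.
- rewrite left; have -> : 2%:E = (1 + 1)%E :> \bar R by rewrite -EFinD.
  rewrite leeD2l// -right; apply: ge0_subset_integral => //.
  + exact: measurable_funS mE.
  + by move=> x /=; rewrite !in_itv/= !andbT => /ltW.
- exact: measurable_funS mE.
- apply/disj_setPS => x /= []; rewrite !in_itv/= andbT => xc cx.
  by move: (le_lt_trans xc cx); rewrite ltxx.
Qed.

(** sin x = 2 sin(x/2) cos(x/2), and the mean value theorem gives sin(x/2) = (x/2) cos xi with xi <
    x/2; then cos xi >= cos(x/2) and 2 cos(x/2)^2 = 1 + cos x >= 1. *)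
Lemma half_le_sin x : 0 <= x <= pi / 2 -> x / 2 <= sin x.
Proof.
move=> /andP[x0 xp].
have [->|xn0] := eqVneq x 0; first by rewrite mul0r sin0.
have y0 : 0 < x / 2 by rewrite divr_gt0// lt_neqAle eq_sym xn0.
have [xi] := @MVT R sin cos 0 (x / 2) y0 (fun t _ => is_derive_sin t)
  (continuous_subspaceT (@continuous_sin R)).
rewrite in_itv/= => /andP[xi0 xiy]; rewrite sin0 !subr0 => E.
have pi0 := pi_gt0 R.
have cc : cos (x / 2) <= cos xi.
  by rewrite ltW// ltr_cos// in_itv/=; apply/andP; split; lra.
have ex : x = (x / 2) *+ 2 by rewrite mulr2n -splitr.
have c2 : 1 <= 2 * cos (x / 2) ^+ 2.
  have : 0 <= cos x by apply: cos_ge0_pihalf; apply/andP; split; lra.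
  by rewrite {1}ex cos_mulr2n; lra.
have c0 : 0 <= cos (x / 2) by apply: cos_ge0_pihalf; apply/andP; split; lra.
have h : 1 <= 2 * (cos (x / 2) * cos xi) by nra.
have -> : sin x = 2 * (cos (x / 2) * cos xi) * (x / 2).
  by rewrite [in LHS]ex sin_mulr2n E; ring.
by have := ler_wpM2r (ltW y0) h; rewrite mul1r.
Qed.

(** The right side is sin(x/2)^2, so [half_le_sin] applies at x/2; evenness reduces to x >= 0. *)
Lemma sqr_le_one_sub_cos x : `|x| <= pi -> (x / 4) ^+ 2 <= (1 - cos x) / 2.
Proof.
wlog x0 : x / 0 <= x => [h xp|].
  have [x0|/ltW x0] := leP 0 x; first exact: h.
  have := h (- x); rewrite oppr_ge0 normrN cosN mulNr sqrrN; exact.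
rewrite ger0_norm// => xp.
have := @half_le_sin (x / 2); rewrite divr_ge0//=.
have -> : x / 2 <= pi / 2 by rewrite ler_pM2r.
move=> /(_ isT) h.
have e : x = (x / 2) *+ 2 by rewrite mulr2n -splitr.
rewrite {2}e cos_mulr2n cos2sin2.
have : (x / 4) ^+ 2 <= sin (x / 2) ^+ 2.
  rewrite ler_sqr ?nnegrE ?divr_ge0//; first by lra.
  by apply: le_trans h; rewrite !divr_ge0.
by lra.
Qed.

Lemma polar_form (z : R[i]) : exists2 th : R, - pi <= th <= pi &
  z = (cabs z * cos th) +i* (cabs z * sin th).
Proof.
have pi0 := pi_gt0 R.
have [z0|z0] := eqVneq (cabs z) 0.
  exists 0; first by apply/andP; split; lra.
  by rewrite z0 !mul0r (Normc.eq0_normc z0).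
have zp : 0 < cabs z by rewrite lt_neqAle eq_sym z0 normc_ge0.
set x := Re z / cabs z.
have x1 : -1 <= x <= 1.
  by rewrite -ler_norml normrM normfV [`|cabs z|]gtr0_norm// ler_pdivrMr// mul1r Re_le_normc.
have cx : cos (acos x) = x by rewrite acosK// in_itv.
have sx : cabs z * sin (acos x) = `|Im z|.
  apply/eqP; rewrite -(@eqrXn2 _ 2)// ?mulr_ge0 ?normc_ge0 ?sin_ge0_pi ?acos_ge0 ?acos_lepi//.
  rewrite real_normK ?num_real// exprMn sin2cos2 cx /x expr_div_n.
  by rewrite mulrBr mulr1 mulrCA divff ?expf_neq0// mulr1 normc_sqr addrAC subrr add0r.
have [i0|/ltW i0] := leP 0 (Im z).
- exists (acos x); first by rewrite acos_lepi// andbT (le_trans _ (acos_ge0 x1))//; lra.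
  rewrite cx sx ger0_norm// /x mulrCA divff// mulr1.
  exact: complex_ext.
- exists (- acos x); first by rewrite lerN2 acos_lepi//= (le_trans _ (ltW pi0))// oppr_le0 acos_ge0.
  rewrite cosN sinN mulrN cx sx ler0_norm// opprK /x mulrCA divff// mulr1.
  exact: complex_ext.
Qed.

(** |B| dominates both the radial quantity A/2 and the angular quantity |x - th|/4. *)
Lemma kB_expi (z : R[i]) th x : cabs z < 1 -> `|x - th| <= pi ->
  z = (cabs z * cos th) +i* (cabs z * sin th) ->
  (1 - cabs z ^+ 2 + `|x - th|) / 8 <= cabs (kB z (expi x)).
Proof.
move=> z1 xp ez.
have z0 := normc_ge0 z.
have h1 := kB_ge (expi x) z1.
have h2 : `|x - th| / 4 <= cabs (kB z (expi x)).
  rewrite -ler_sqr ?nnegrE ?normc_ge0 ?divr_ge0// expr_div_n real_normK ?num_real//.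
  rewrite -expr_div_n; apply: le_trans (sqr_le_one_sub_cos xp) _.
  have -> : cabs (kB z (expi x)) ^+ 2 = 1 - 2 * cabs z * cos (x - th) + cabs z ^+ 2.
    have eR := congr1 (@complex.Re R) ez; have eI := congr1 (@complex.Im R) ez.
    rewrite normc_sqr /kB cReD cImD cReN cImN cReM cImM cReJ cImJ cosB eR eI /=.
    transitivity (1 - 2 * cabs z * (cos x * cos th + sin x * sin th) +
      cabs z ^+ 2 * ((cos x ^+ 2 + sin x ^+ 2) * (cos th ^+ 2 + sin th ^+ 2))).
      by ring.
    by rewrite !cos2Dsin2 !mulr1.
  have := cos_le1 (x - th); have := cos_geN1 (x - th).
  (* With r = |z| and c = cos(x - th), |B|^2 = (1 - r)^2 + 2 r (1 - c). For r >= 1/4 the last term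
     suffices; for smaller r, 1 - c <= 2 leaves (1 - r)^2 - (1 - 4 r) = r^2 + 2 r >= 0. *)
  have [|] := leP (1 / 4) (cabs z); nra.
have := normr_ge0 (x - th); have := one_sub_sqr_gt0 z1; lra.
Qed.

Lemma majorant_le_sym_ker sg (z : R[i]) th x : 0 < sg -> cabs z < 1 -> `|x - th| <= pi ->
  z = (cabs z * cos th) +i* (cabs z * sin th) ->
  majorant sg z (expi x) <= 8 `^ (sg + 1) / sg * sym_ker sg (1 - cabs z ^+ 2) th x.
Proof.
move=> sg0 z1 xp ez; have h := kB_expi z1 xp ez.
have d0 := one_sub_sqr_gt0 z1.
rewrite /majorant /sym_ker; set d := 1 - _ in d0 h *.
have dx : 0 < d + `|x - th| by rewrite ltr_wpDr.
have -> : 8 `^ (sg + 1) / sg * (sg * d `^ sg * (d + `|x - th|) `^ (- (sg + 1))) =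
    d `^ sg * (8 `^ (sg + 1) * (d + `|x - th|) `^ (- (sg + 1))).
  by field; rewrite gt_eqF.
rewrite ler_wpM2l ?powR_ge0//.
have -> : 8 `^ (sg + 1) * (d + `|x - th|) `^ (- (sg + 1)) =
    (((d + `|x - th|) / 8) `^ (sg + 1))^-1.
  rewrite powRM ?invr_ge0 ?ltW// -[8^-1]powR_inv1// -powRrM mulN1r.
  by rewrite invfM [in RHS]powRN invrK mulrC powRN.
rewrite lef_pV2 ?posrE ?powR_gt0 ?kB_gt0 ?divr_gt0//.
apply: (ge0_ler_powR _ _ _ h); rewrite ?nnegrE ?normc_ge0 ?divr_ge0 ?ltW//.
by rewrite addr_gt0.
Qed.

Lemma integral_majorant sg : 0 < sg ->
  exists2 C : R, 0 <= C & forall z : R[i], cabs z < 1 ->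
    (\int[@arc_measure R]_s (majorant sg z s)%:E <= C%:E)%E.
Proof.
move=> sg0; set M := 8 `^ (sg + 1) / sg.
have M0 : 0 <= M by rewrite divr_ge0 ?powR_ge0 ?ltW.
have tp := @twopi_gt0 R; have pi0 := pi_gt0 R.
(* The inverse is the uniform density, in the shape given by [integral_uniform]; M is the pointwise
   comparison constant, and 4 bounds the mass of two symmetric kernels. *)
exists ((2 * pi - 0)^-1 * (M * 4)) => [|z z1].
  by rewrite subr0 !mulr_ge0 ?invr_ge0 ?ltW.
have mk : measurable_fun setT (fun s : borel_circle R => (majorant sg z s)%:E).
  apply/measurable_EFinP; exact: measurable_majorant.
rewrite ge0_integral_distribution//; last by move=> s; rewrite lee_fin majorant_ge0.
rewrite integral_uniform//; last 2 first.
- exact: measurableT_comp mk (@measurable_expiT R).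
- by move=> s; rewrite lee_fin majorant_ge0.
rewrite EFinM lee_wpmul2l ?lee_fin ?invr_ge0 ?subr0 ?(ltW tp)//.
have [th /andP[th1 th2] ez] := polar_form z.
have ez2 : z = (cabs z * cos (th + pi *+ 2)) +i* (cabs z * sin (th + pi *+ 2)).
  by rewrite cosD2pi sinD2pi.
set d := 1 - cabs z ^+ 2; have d0 : 0 < d := one_sub_sqr_gt0 z1.
(* For x in [0, 2 pi] and th in [-pi, pi], x lies within pi of th or of th + 2 pi, so kernels at
   both centres cover every case. *)
pose H x := sym_ker sg d th x + sym_ker sg d (th + pi *+ 2) x.
have mH : measurable_fun setT H by apply: measurable_funD; exact: measurable_sym_ker.
have H0 x : 0 <= H x by rewrite addr_ge0 ?sym_ker_ge0// ltW.
apply: (@le_trans _ _ (\int[mu]_(x in `[0%R, (2 * pi)%R]) (M%:E * (H x)%:E))%E).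
  apply: ge0_le_integral => //.
  - by move=> x _; rewrite lee_fin majorant_ge0.
  - apply: measurable_funTS; exact: measurableT_comp mk (@measurable_expiT R).
  - by apply: measurable_funTS; apply/measurable_EFinP; exact: measurable_funM.
  move=> x /=; rewrite in_itv/= => /andP[x0 x2].
  rewrite -EFinM lee_fin.
  have [xt|xt] := leP `|x - th| pi.
    apply: le_trans (majorant_le_sym_ker sg0 z1 xt ez) _.
    by rewrite ler_wpM2l// lerDl sym_ker_ge0// ltW.
  have xt2 : `|x - (th + pi *+ 2)| <= pi.
    rewrite ler_norml mulr2n; move: xt; rewrite ltr_normr => /orP[] ?;
      apply/andP; split; lra.
  apply: le_trans (majorant_le_sym_ker sg0 z1 xt2 ez2) _.
  by rewrite ler_wpM2l// lerDr sym_ker_ge0// ltW.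
rewrite ge0_integralZl//=; last 2 first.
- by apply: measurable_funTS; exact/measurable_EFinP.
- by move=> x _; rewrite lee_fin.
rewrite [X in (_ <= X)%E]EFinM lee_wpmul2l ?lee_fin//.
apply: (@le_trans _ _ (\int[mu]_x (H x)%:E)%E).
  apply: ge0_subset_integral => //; first exact/measurable_EFinP.
  by move=> x _; rewrite lee_fin.
under eq_integral do rewrite EFinD.
rewrite ge0_integralD//=; last 4 first.
- by move=> x _; rewrite lee_fin sym_ker_ge0// ltW.
- apply/measurable_EFinP; exact: measurable_sym_ker.
- by move=> x _; rewrite lee_fin sym_ker_ge0// ltW.
- apply/measurable_EFinP; exact: measurable_sym_ker.
have -> : 4%:E = (2%:E + 2%:E)%E :> \bar R by rewrite -EFinD -natrD.
by rewrite leeD// integral_sym_ker.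
Qed.

End CircleKernelIntegral.

(** * The majorant against an L^p function *)

Section KernelLp.
Variable R : realType.
Local Notation T := (borel_circle R).
Local Notation mu := (@arc_measure R).
Implicit Types (z : R[i]) (phi : T -> R[i]) (sg r : R).

Local Notation gap z := (1 - cabs z ^+ 2).

Lemma measurable_majorant_normc sg z phi : cmeas phi ->
  measurable_fun setT (fun s : T => (majorant sg z s * cabs (phi s))%:E).
Proof.
move=> mphi; apply/measurable_EFinP; apply: measurable_funM.
  exact: measurable_majorant.
exact: cmeas_normc.
Qed.

Lemma le1DpowR (x r : R) : 0 <= x -> 1 <= r -> x <= 1 + x `^ r.
Proof.
move=> x0 r1; have [x1|/ltW x1] := leP x 1.
  by rewrite (le_trans x1)// lerDl powR_ge0.
by rewrite -[leLHS]powRr1// ler_wpDl// ler_powR.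
Qed.

(* Young's inequality in the crude form x <= M + M^(1-r) x^r, used with
   M = N (1-|z|^2)^(-1/r), balances the L^1 bound and the sup bound on the
   kernel: this replaces Hoelder's inequality. *)
Lemma kernel_Lr sg r C1 z phi : 1 <= r -> 0 < sg -> cabs z < 1 ->
  0 <= C1 -> (\int[mu]_s (majorant sg z s)%:E <= C1%:E)%E ->
  cmeas phi -> (circle_norm r%:E phi < +oo)%E ->
  (\int[mu]_s (majorant sg z s * cabs (phi s))%:E <=
   ((C1 + 2 `^ (sg + 1)) * (fine (circle_norm r%:E phi) / gap z `^ r^-1))%:E)%E.
Proof.
move=> r1 sg0 z1 C10 hC1 mphi Nfin.
have r0 : 0 < r by lra.
have g0 := one_sub_sqr_gt0 z1.
set D := 2 `^ (sg + 1); have D0 : 0 < D by rewrite powR_gt0.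
set N := fine (circle_norm r%:E phi).
have N0 : 0 <= N by rewrite fine_ge0// Lnorm_ge0.
have NE : circle_norm r%:E phi = N%:E.
  by rewrite fineK// ge0_fin_numE// Lnorm_ge0.
have intN : (\int[mu]_s (cabs (phi s) `^ r)%:E = (N `^ r)%:E)%E.
  rewrite -poweR_EFin -NE /circle_norm poweR_Lnorm ?gt_eqF//.
  by apply: eq_integral => s _; rewrite gee0_abs ?lee_fin ?normc_ge0.
have mpow : measurable_fun setT (fun s : T => (cabs (phi s) `^ r)%:E).
  apply/measurable_EFinP; apply: (measurableT_comp (measurable_powR _)).
  exact: cmeas_normc.
have mk : measurable_fun setT (fun s : T => (majorant sg z s)%:E).
  by apply/measurable_EFinP; exact: measurable_majorant.
set b := gap z `^ r^-1; have b0 : 0 < b by rewrite powR_gt0.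
have br : b `^ r = gap z by rewrite -powRrM mulVf ?gt_eqF// powRr1// ltW.
(* N may be 0 while M must be invertible, so the estimate is proved for positive N' >= N, and N'
   tends to N afterwards. *)
have key N' : 0 < N' -> N <= N' ->
    (\int[mu]_s (majorant sg z s * cabs (phi s))%:E <= ((C1 + D) * (N' / b))%:E)%E.
  move=> N'0 NN'; set M := N' / b; have M0 : 0 < M by rewrite divr_gt0.
  (* w is the sup bound on the kernel times M^(1-r). Since b^r = A, w N^r is at most D M, which
     matches the first term C1 M. *)
  set w := D / gap z * (M / M `^ r).
  have w0 : 0 <= w by rewrite !mulr_ge0 ?invr_ge0 ?powR_ge0// ltW.
  apply: (@le_trans _ _ (\int[mu]_s (M%:E * (majorant sg z s)%:E +
      w%:E * (cabs (phi s) `^ r)%:E))%E).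
    apply: ge0_le_integral => //.
    - by move=> s _; rewrite lee_fin mulr_ge0 ?majorant_ge0 ?normc_ge0.
    - exact: measurable_majorant_normc.
    - by apply: emeasurable_funD; exact: measurable_funeM.
    - move=> s _; rewrite -!EFinM -EFinD lee_fin.
      have h := @le1DpowR (cabs (phi s) / M) r (divr_ge0 (normc_ge0 _) (ltW M0)) r1.
      have {}h : cabs (phi s) <= M + M / M `^ r * cabs (phi s) `^ r.
        move: h; rewrite powRM ?normc_ge0 ?invr_ge0 ?(ltW M0)//.
        have -> : M^-1 `^ r = (M `^ r)^-1.
          by rewrite -[M^-1]powR_inv1 ?(ltW M0)// -powRrM mulN1r powRN.
        move=> /(ler_wpM2l (ltW M0)).
        rewrite mulrCA divff ?gt_eqF// mulr1 => /le_trans; apply.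
        by rewrite mulrDr mulr1 [_ / M `^ r]mulrC mulrA.
      have := ler_wpM2l (majorant_ge0 sg z s) h => /le_trans; apply.
      rewrite mulrDr [majorant _ _ _ * M]mulrC lerD2l.
      have -> : w * cabs (phi s) `^ r =
          D / gap z * (M / M `^ r * cabs (phi s) `^ r) by rewrite /w !mulrA.
      by rewrite ler_wpM2r ?majorant_le ?(ltW sg0)// mulr_ge0 ?powR_ge0// divr_ge0 ?powR_ge0// ltW.
  rewrite ge0_integralD//=; last 4 first.
  - by move=> s _; rewrite mule_ge0 ?lee_fin ?majorant_ge0// ltW.
  - exact: measurable_funeM.
  - by move=> s _; rewrite mule_ge0 ?lee_fin ?powR_ge0.
  - exact: measurable_funeM.
  rewrite !ge0_integralZl_EFin//; last 3 first.
  - by move=> s _; rewrite lee_fin powR_ge0.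
  - by move=> s _; rewrite lee_fin majorant_ge0.
  - exact: ltW.
  rewrite intN [(C1 + D) * M]mulrDl EFinD leeD//.
    by rewrite [(C1 * M)%:E]EFinM [leRHS]muleC lee_wpmul2l// lee_fin ltW.
  rewrite -EFinM lee_fin.
  have NM : N `^ r <= M `^ r * gap z.
    rewrite -br -powRM ?(ltW M0) ?(ltW b0)// /M divfK ?gt_eqF//.
    by apply: (ge0_ler_powR (ltW r0)) NN'; rewrite nnegrE// ltW.
  apply: le_trans (ler_wpM2l w0 NM) _.
  rewrite /w le_eqVlt; apply/orP; left; apply/eqP.
  by field; rewrite !gt_eqF// powR_gt0.
apply/lee_addgt0Pr => e e0.
have K0 : 0 < (C1 + D) / b by rewrite divr_gt0// ltr_wpDl.
(* The increment makes the bound exceed the target by exactly e. *)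
have := key (N + e / ((C1 + D) / b)).
have -> : (C1 + D) * ((N + e / ((C1 + D) / b)) / b) = (C1 + D) * (N / b) + e.
  by field; rewrite !gt_eqF// ltr_wpDl.
rewrite -EFinD; apply; first by rewrite ltr_wpDl// divr_gt0.
by rewrite lerDl ltW// divr_gt0.
Qed.

Lemma kernel_Linfty sg C1 z phi :
  0 <= C1 -> (\int[mu]_s (majorant sg z s)%:E <= C1%:E)%E ->
  cmeas phi -> (circle_norm +oo%E phi < +oo)%E ->
  (\int[mu]_s (majorant sg z s * cabs (phi s))%:E <=
   (C1 * fine (circle_norm +oo%E phi))%:E)%E.
Proof.
move=> C10 hC1 mphi Nfin.
set N := fine (circle_norm +oo%E phi).
have N0 : 0 <= N by rewrite fine_ge0// Lnorm_ge0.
have NE : circle_norm +oo%E phi = N%:E.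
  by rewrite fineK// ge0_fin_numE// Lnorm_ge0.
have mk : measurable_fun setT (fun s : T => (majorant sg z s)%:E).
  by apply/measurable_EFinP; exact: measurable_majorant.
have : \forall s \ae mu, (`|(cabs (phi s))%:E| <= N%:E)%E.
  (* The norm at +oo is the essential supremum only on a space of positive measure; here the total
     mass is 1. *)
  apply/ess_sup_inf.ess_supP; rewrite -NE /circle_norm unlock ifT//.
  by apply: lt_le_trans (lte01) _; rewrite le_eqVlt;
    apply/orP; left; apply/eqP/esym; exact: (probability_setT (@arc_measure R)).
move=> hae.
apply: (@le_trans _ _ (\int[mu]_s (N%:E * (majorant sg z s)%:E))%E).
  apply: ae_ge0_le_integral => //.
  - by move=> s _; rewrite lee_fin mulr_ge0 ?majorant_ge0 ?normc_ge0.
  - exact: measurable_majorant_normc.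
  - by move=> s _; rewrite mule_ge0 ?lee_fin ?majorant_ge0.
  - exact: measurable_funeM.
  - apply: filterS hae => s + _; rewrite gee0_abs ?lee_fin ?normc_ge0// => h.
    by rewrite mulrC ler_wpM2r ?majorant_ge0.
rewrite ge0_integralZl_EFin//; last by move=> s _; rewrite lee_fin majorant_ge0.
by rewrite [C1 * N]mulrC [(N * C1)%:E]EFinM lee_wpmul2l// lee_fin.
Qed.

Lemma kernel_Lp sg (p : \bar R) : 0 < sg -> (1%:E <= p)%E ->
  exists2 C : R, 0 <= C & forall phi, in_Lp p phi -> forall z, cabs z < 1 ->
   (\int[mu]_s (majorant sg z s * cabs (phi s))%:E <=
    (C * (fine (circle_norm p phi) / gap z `^ fine (p^-1)%E))%:E)%E.
Proof.
move=> sg0 p1; have [C1 C10 hC1] := integral_majorant sg0.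
exists (C1 + 2 `^ (sg + 1)) => [|phi [mr mi Nfin] z z1].
  by rewrite addr_ge0 ?powR_ge0.
have mphi : cmeas phi by [].
case: p p1 Nfin => [r| |//] r1 Nfin.
- rewrite lee_fin in r1.
  have r0 : r != 0 by rewrite gt_eqF// (lt_le_trans _ r1).
  have -> : fine (r%:E^-1)%E = r^-1 by rewrite inver (negbTE r0).
  by apply: kernel_Lr => //; exact: hC1.
- apply: le_trans (kernel_Linfty C10 (hC1 _ z1) mphi Nfin) _.
  (* The inverse of +oo is 0, so the power of A is 1. *)
  rewrite invey /= powRr0 divr1 lee_fin ler_wpM2r ?fine_ge0 ?Lnorm_ge0//.
  by rewrite lerDl powR_ge0.
Qed.

(** At z = 0 the majorant is identically 1, so the L^p estimate there, taken with sg = 1, is the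
    inclusion of L^p in L^1. *)
Lemma integrable_normc (p : \bar R) phi : (1%:E <= p)%E -> in_Lp p phi ->
  mu.-integrable setT (fun s => (cabs (phi s))%:E).
Proof.
move=> p1 Lphi; have [mr mi _] := Lphi.
have z0 : cabs (0 : R[i]) < 1 by rewrite Normc.normc0.
have [C C0 /(_ phi Lphi 0 z0) h] := kernel_Lp (@ltr01 R) p1.
apply/integrableP; split.
  by apply/measurable_EFinP; exact: cmeas_normc.
apply: le_lt_trans (ltry _); apply: le_trans h.
rewrite le_eqVlt; apply/orP; left; apply/eqP; apply: eq_integral => s _.
rewrite gee0_abs ?lee_fin ?normc_ge0// /majorant /kB mul0r subr0 Normc.normc0.
by rewrite Normc.normc1 expr0n subr0 !powR1 divr1 mul1r.
Qed.

End KernelLp.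

(** * Differentiation under the integral sign *)

Section CircleIntegral.
Variable R : realType.
Local Notation T := (borel_circle R).
Local Notation mu := (@arc_measure R).
Implicit Types (g h phi : T -> R[i]) (c : R[i]).

Definition cintegrable g : Prop :=
  mu.-integrable setT (EFin \o (fun s => Re (g s))) /\
  mu.-integrable setT (EFin \o (fun s => Im (g s))).

Lemma cintegrable_le g (h : T -> R) : cmeas g ->
  mu.-integrable setT (EFin \o h) -> (forall s, cabs (g s) <= h s) ->
  cintegrable g.
Proof.
move=> [mr mi] ih gh; split.
- apply: le_integrable ih => //; first exact/measurable_EFinP.
  move=> s _; rewrite /= lee_fin (le_trans (Re_le_normc _))//.
  by rewrite (le_trans (gh _))// ler_norm.
- apply: le_integrable ih => //; first exact/measurable_EFinP.
  move=> s _; rewrite /= lee_fin (le_trans (Im_le_normc _))//.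
  by rewrite (le_trans (gh _))// ler_norm.
Qed.

Lemma circle_integralD g h : cintegrable g -> cintegrable h ->
  circle_integral (fun s => g s + h s) = circle_integral g + circle_integral h.
Proof.
move=> [gr gi] [hr hi]; apply: complex_ext; rewrite /circle_integral /=.
- by rewrite -RintegralD//; apply: eq_Rintegral => s _; rewrite cReD.
- by rewrite -RintegralD//; apply: eq_Rintegral => s _; rewrite cImD.
Qed.

Lemma integrable_scale (h : T -> R) (c : R) :
  mu.-integrable setT (EFin \o h) ->
  mu.-integrable setT (EFin \o (fun s => h s * c)).
Proof.
move=> ih; have := integrableZl measurableT c ih.
by apply: eq_integrable => // s _; rewrite /= mulrC.
Qed.

Lemma circle_integralZr g c : cintegrable g ->
  circle_integral (fun s => g s * c) = circle_integral g * c.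
Proof.
move=> [gr gi]; apply: complex_ext; rewrite ?cReM ?cImM /circle_integral /=.
- rewrite -!RintegralZr// -RintegralB//; last 2 first.
  + exact: integrable_scale.
  + exact: integrable_scale.
  by apply: eq_Rintegral => s _; rewrite cReM.
- rewrite -!RintegralZr// -RintegralD//; last 2 first.
  + exact: integrable_scale.
  + exact: integrable_scale.
  by apply: eq_Rintegral => s _; rewrite cImM.
Qed.

Lemma cintegrableZr g c : cintegrable g -> cintegrable (fun s => g s * c).
Proof.
move=> [gr gi]; split.
- have := integrableB measurableT (integrable_scale (Re c) gr)
    (integrable_scale (Im c) gi).
  by apply: eq_integrable => // s _; rewrite /= cReM.
- have := integrableD measurableT (integrable_scale (Im c) gr)
    (integrable_scale (Re c) gi).
  by apply: eq_integrable => // s _; rewrite /= cImM.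
Qed.

(** The two components are bounded separately, each by C: this is the origin of the factor 2. *)
Lemma normc_circle_integral g (h : T -> R) (C : R) : cmeas g ->
  mu.-integrable setT (EFin \o h) -> (forall s, cabs (g s) <= h s) ->
  (\int[mu]_s (h s)%:E <= C%:E)%E ->
  cabs (circle_integral g) <= 2 * C.
Proof.
move=> mg ih gh hC; have [gr gi] := cintegrable_le mg ih gh.
apply: le_trans (normc_le_ReIm _) _; rewrite mulr_natl mulr2n.
have hC' : Rintegral mu setT h <= C.
  rewrite -lee_fin /Rintegral fineK//.
  exact: integrable_fin_num.
have bound (f : T -> R) : mu.-integrable setT (EFin \o f) ->
    (forall s, `|f s| <= h s) -> `|Rintegral mu setT f| <= C.
  move=> fi fh; apply: le_trans hC'; apply: le_trans (le_normr_Rintegral _ fi) _ => //.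
  apply: le_Rintegral => //.
  by have := integrable_norm fi; exact.
by apply: lerD; apply: bound => // s; apply: le_trans (gh s);
  [exact: Re_le_normc|exact: Im_le_normc].
Qed.

End CircleIntegral.

(** * Local domination and derivatives of kernel integrals *)

Section Differentiation.
Variable R : realType.
Local Notation T := (borel_circle R).
Local Notation mu := (@arc_measure R).
Variables al be : R[i].
Hypothesis hab : 0 < Re al + Re be + 1.
Implicit Types (z v : R[i]) (phi : T -> R[i]) (f p q : R[i] -> circle R -> R[i]).

Definition kernel_int f phi z : R[i] :=
  circle_integral (fun s => ukernel al be z s * f z s * phi s).

Lemma ukernel_rat_bound n f : rat_ker n f -> exists2 C : R, 0 <= C &
  forall z s, cabs z < 1 -> cabs (ukernel al be z s * f z s) <=
    C / (1 - cabs z ^+ 2) ^+ n * majorant (Re al + Re be + 1) z s.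
Proof.
move=> rf; have [C C0 hC] := rat_ker_bound rf.
have [C' C'0 hC'] := ukernel_bound al be.
exists (C' * C) => [|z s z1]; first exact: mulr_ge0.
rewrite Normc.normcM.
have -> : C' * C / (1 - cabs z ^+ 2) ^+ n * majorant (Re al + Re be + 1) z s =
  (C' * majorant (Re al + Re be + 1) z s) * (C / (1 - cabs z ^+ 2) ^+ n) by ring.
by rewrite ler_pM ?normc_ge0 ?hC ?hC'.
Qed.

(** A bound uniform on a smaller disc gives B |phi| as dominating function near each point, so
    integrability of phi is enough to differentiate under the integral. *)
Lemma ukernel_rat_bounded n f (rho : R) : rat_ker n f -> 0 <= rho < 1 ->
  exists2 B : R, 0 <= B & forall z s, cabs z <= rho ->
    cabs (ukernel al be z s * f z s) <= B.
Proof.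
move=> rf /andP[rho0 rho1]; have [C C0 hC] := ukernel_rat_bound rf.
have g0 : 0 < 1 - rho ^+ 2 by rewrite subr_gt0 expr_lt1.
exists (C / (1 - rho ^+ 2) ^+ n * (2 `^ (Re al + Re be + 1 + 1) / (1 - rho ^+ 2))).
  by rewrite !mulr_ge0 ?invr_ge0 ?powR_ge0 ?exprn_ge0// ltW.
move=> z s zr; have z1 := le_lt_trans zr rho1.
have gz := one_sub_sqr_gt0 z1.
have gg : 1 - rho ^+ 2 <= 1 - cabs z ^+ 2.
  by rewrite lerD2l lerN2 ler_sqr ?nnegrE ?normc_ge0.
apply: le_trans (hC z s z1) _; apply: ler_pM.
- by rewrite mulr_ge0 ?invr_ge0 ?exprn_ge0// ltW.
- exact: majorant_ge0.
- rewrite ler_wpM2l// lef_pV2 ?posrE ?exprn_gt0//.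
  by rewrite lerXn2r ?nnegrE// ltW.
- apply: (le_trans (majorant_le s (ltW hab) z1)).
  by rewrite ler_wpM2l ?powR_ge0// lef_pV2 ?posrE.
Qed.

Variable phi : T -> R[i].
Hypothesis mphi : cmeas phi.
Hypothesis iphi : mu.-integrable setT (EFin \o (fun s => cabs (phi s))).

Lemma integrable_scale_phi (B : R) :
  mu.-integrable setT (EFin \o (fun s => B * cabs (phi s))).
Proof.
by have := integrableZl measurableT B iphi; apply: eq_integrable.
Qed.

Lemma cmeas_kernel n f z : rat_ker n f -> cabs z < 1 ->
  cmeas (fun s => ukernel al be z s * f z s * phi s).
Proof.
move=> rf z1; apply: cmeasM => //; apply: cmeasM; first exact: cmeas_ukernel.
exact: rat_ker_cmeas rf.
Qed.

Lemma cintegrable_kernel n f z : rat_ker n f -> cabs z < 1 ->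
  cintegrable (fun s => ukernel al be z s * f z s * phi s).
Proof.
move=> rf z1.
have [|B B0 hB] := ukernel_rat_bounded rf (rho := cabs z).
  by rewrite normc_ge0.
apply: (cintegrable_le (cmeas_kernel rf z1) (integrable_scale_phi B)) => s.
by rewrite Normc.normcM ler_wpM2r ?normc_ge0 ?hB.
Qed.

Lemma normc_real (t : R) : cabs (t%:C) = `|t|.
Proof. by rewrite /= expr0n addr0 sqrtr_sqr. Qed.

Lemma normc_line z v (t : R) : cabs v <= 1 ->
  cabs (z + t%:C * v) <= cabs z + `|t|.
Proof.
move=> v1; apply: le_trans (le_normcD _ _) _.
by rewrite lerD2l Normc.normcM normc_real ler_piMr.
Qed.

Lemma Rintegral_deriv (F D : R -> T -> R) (G : T -> R) (e : R) : 0 < e ->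
  (forall t, `|t| < e -> mu.-integrable setT (EFin \o F t)) ->
  (forall (t : R) (s : T), `|t| < e -> is_derive t 1 (F^~ s) (D t s)) ->
  mu.-integrable setT (EFin \o G) ->
  (forall t s, `|t| < e -> `|D t s| <= G s) ->
  is_derive (0 : R) 1 (fun t => Rintegral mu setT (F t)) (Rintegral mu setT (D 0)).
Proof.
move=> e0 iF dF iG DG.
have I0 : `](- e), e[%classic (0 : R) by rewrite /= in_itv/= oppr_lt0 e0.
have Ie t : `](- e), e[%classic t -> `|t| < e by rewrite /= in_itv/= ltr_norml.
have G0 s : 0 <= G s by apply: le_trans (DG 0 s _); rewrite ?normr0.
have pE t s : `|t| < e -> partial1of2 F t s = D t s.
  by move=> te; rewrite partial1of2E; have := dF t s te => ?; exact: derive_val.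
have iF' t : `](- e), e[%classic t -> mu.-integrable setT (EFin \o F t).
  by move=> /Ie; exact: iF.
have dF' t s : `](- e), e[%classic t -> [set: T] s -> derivable (F^~ s) t 1.
  by move=> /Ie te _; have := dF t s te => ?; exact: ex_derive.
have bF t s : `](- e), e[%classic t -> [set: T] s -> `|partial1of2 F t s| <= G s.
  by move=> /Ie te _; rewrite pE// DG.
apply: DeriveDef.
  exact: (derivable_under_integral measurableT I0 iF' dF' G0 iG bF).
rewrite -derive1E (differentiation_under_integral measurableT I0 iF' dF' G0 iG bF).
by apply: eq_Rintegral => s _; rewrite pE// normr0.
Qed.

Lemma cderiv_kernel_int m n f p q z v : rat_ker n p -> rat_ker n q ->
  rat_ker m f -> cabs z < 1 -> cabs v <= 1 ->
  (forall w s, cabs w < 1 -> wirtinger (fun y => ukernel al be y s * f y s) w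
     (ukernel al be w s * p w s) (ukernel al be w s * q w s)) ->
  cderiv (fun t : R => kernel_int f phi (z + t%:C * v)) 0
    (kernel_int p phi z * v + kernel_int q phi z * conjc v).
Proof.
move=> rp rq rf z1 v1 hw.
have z0 := normc_ge0 z.
(* Half the distance to the circle: for |t| < e and |v| <= 1 the point z + t v stays in the disc of
   radius [rho]. *)
pose e := (1 - cabs z) / 2; have e0 : 0 < e by rewrite /e; lra.
pose rho := (1 + cabs z) / 2.
have rho01 : 0 <= rho < 1 by apply/andP; split; rewrite /rho; lra.
have disc t : `|t| < e -> cabs (z + t%:C * v) <= rho.
  move=> te; apply: le_trans (normc_line _ _ v1) _; rewrite /rho; rewrite /e in te; lra.
have disc1 t : `|t| < e -> cabs (z + t%:C * v) < 1.
  by move=> /disc /le_lt_trans; apply; case/andP: rho01.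
have [Bp Bp0 hBp] := ukernel_rat_bounded rp rho01.
have [Bq Bq0 hBq] := ukernel_rat_bounded rq rho01.
pose G s := (Bp + Bq) * cabs (phi s).
have iG : mu.-integrable setT (EFin \o G) := integrable_scale_phi _.
pose F t s := ukernel al be (z + t%:C * v) s * f (z + t%:C * v) s * phi s.
pose D t s := (ukernel al be (z + t%:C * v) s * p (z + t%:C * v) s * v +
  ukernel al be (z + t%:C * v) s * q (z + t%:C * v) s * conjc v) * phi s.
have dF t s : `|t| < e -> cderiv (F^~ s) t (D t s).
  move=> te; have := wirtinger_line (hw _ s (disc1 _ te)).
  move=> /cderivM /(_ (cderiv_cst t (phi s))) h; apply: (cderiv_eq h).
  by rewrite mulr0 addr0.
have bD t s : `|t| < e -> cabs (D t s) <= G s.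
  move=> te; rewrite Normc.normcM ler_wpM2r ?normc_ge0//.
  apply: le_trans (le_normcD _ _) _; rewrite lerD// Normc.normcM.
  - by rewrite (le_trans _ (hBp _ s (disc _ te)))// ler_piMr ?normc_ge0.
  - by rewrite (le_trans _ (hBq _ s (disc _ te)))// ler_piMr ?normc_ge0// normc_conj.
have iF t : `|t| < e -> cintegrable (F t).
  by move=> te; exact: cintegrable_kernel rf (disc1 _ te).
have -> : kernel_int p phi z * v + kernel_int q phi z * conjc v =
    circle_integral (D 0).
  have ip := cintegrable_kernel rp z1; have iq := cintegrable_kernel rq z1.
  rewrite -circle_integralZr// -circle_integralZr// -circle_integralD; last 2 first.
  - exact: cintegrableZr.
  - exact: cintegrableZr.
  by congr circle_integral; apply/funext => s; rewrite /D line0; ring.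
split.
- apply: (@Rintegral_deriv (fun t s => Re (F t s)) (fun t s => Re (D t s)) G e) => //.
  + by move=> t /iF [].
  + by move=> t s /(dF t s) [].
  + by move=> t s /(bD t s); apply: le_trans; exact: Re_le_normc.
- apply: (@Rintegral_deriv (fun t s => Im (F t s)) (fun t s => Im (D t s)) G e) => //.
  + by move=> t /iF [].
  + by move=> t s /(dF t s) [].
  + by move=> t s /(bD t s); apply: le_trans; exact: Im_le_normc.
Qed.

End Differentiation.

(** * Iterated derivatives of represented functions *)

Section IteratedDerivatives.
Variable R : realType.
Local Notation T := (borel_circle R).
Local Notation mu := (@arc_measure R).
Variables al be : R[i].
Hypothesis hab : 0 < Re al + Re be + 1.
Implicit Types (z v : R[i]) (phi : T -> R[i]) (f g : R[i] -> circle R -> R[i])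
  (u : R[i] -> R[i]).

(** Equality on the disc is enough: a derivative at an interior point sees only nearby points of the
    line. *)
Definition represents u f phi : Prop :=
  forall z, cabs z < 1 -> u z = kernel_int al be f phi z.

Lemma cderiv_derive_along u z v d :
  cderiv (fun t : R => u (z + t%:C * v)) 0 d ->
  derivable_along v u z /\ derive_along v u z = d.
Proof.
move=> [dr di]; split; first by split; exact: ex_derive.
by apply: complex_ext; rewrite /derive_along /= derive1E; exact: derive_val.
Qed.

Lemma normc_i : cabs (0 +i* 1 : R[i]) = 1.
Proof. by rewrite /= expr0n expr1n add0r sqrtr1. Qed.

(** The factors p and q are found before phi and u, which keeps the final constant independent of
    phi. *)
Lemma represents_partials n f : rat_ker n f ->
  exists p q, [/\ rat_ker n.+1 p, rat_ker n.+1 q &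
   forall phi u, cmeas phi ->
    mu.-integrable setT (EFin \o (fun s => cabs (phi s))) ->
    represents u f phi ->
    forall z, cabs z < 1 -> [/\ has_partials u z,
      dz u z = kernel_int al be p phi z & dzbar u z = kernel_int al be q phi z]].
Proof.
move=> rf; have [p [q [rp rq hw]]] := ukernel_wirtinger al be rf.
exists p, q; split => // phi u mphi iphi uf z z1.
have du v : cabs v <= 1 -> cderiv (fun t : R => u (z + t%:C * v)) 0
    (kernel_int al be p phi z * v + kernel_int al be q phi z * conjc v).
  move=> v1.
  have hk := cderiv_kernel_int hab mphi iphi rp rq rf z1 v1 (fun w s => hw w s).
  apply: (near_eq_cderiv _ hk).
  have e0 : 0 < 1 - cabs z by rewrite subr_gt0.
  near=> t; rewrite uf//; apply: le_lt_trans (normc_line _ _ v1) _.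
  rewrite -ltrBrDl; near: t; exact: (@nbhs0_lt R R).
have v1 : cabs (1 : R[i]) <= 1 by rewrite Normc.normc1.
have vi : cabs (0 +i* 1 : R[i]) <= 1 by rewrite normc_i.
have [h1 e1] := cderiv_derive_along (du _ v1).
have [hi ei] := cderiv_derive_along (du _ vi).
have two : (2 : R[i]) != 0 by rewrite pnatr_eq0.
have i2 : (0 +i* 1 : R[i]) * (0 +i* 1) = -1 by exact: sqr_i.
have ji : conjc (0 +i* 1 : R[i]) = - (0 +i* 1).
  by apply: complex_ext; rewrite /= ?oppr0.
split; first by split.
- rewrite /dz e1 ei conjc1 ji.
  set P := kernel_int _ _ p _ _; set Q := kernel_int _ _ q _ _.
  set I := 0 +i* 1 in i2 *.
  (* The derivatives along 1 and i are P + Q and i (P - Q); this combination isolates P because i^2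
     = -1. *)
  transitivity (2^-1 * (P * (1 - I * I) + Q * (1 + I * I))); first by ring.
  by rewrite i2; field.
- rewrite /dzbar e1 ei conjc1 ji.
  set P := kernel_int _ _ p _ _; set Q := kernel_int _ _ q _ _.
  set I := 0 +i* 1 in i2 *.
  transitivity (2^-1 * (P * (1 + I * I) + Q * (1 - I * I))); first by ring.
  by rewrite i2; field.
Unshelve. all: by end_near. Qed.

(** An abstract operator raising the weight by one serves [dz] and [dzbar] alike; the partials of
    the intermediate iterates are what [dz_dzbar_exists] asks for. *)
Lemma represents_iter (op : (R[i] -> R[i]) -> R[i] -> R[i]) :
  (forall n f, rat_ker n f -> exists2 g, rat_ker n.+1 g &
    forall phi u, cmeas phi ->
      mu.-integrable setT (EFin \o (fun s => cabs (phi s))) ->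
      represents u f phi ->
      represents (op u) g phi /\
      forall z, cabs z < 1 -> has_partials u z) ->
  forall k n f, rat_ker n f -> exists2 g, rat_ker (k + n) g &
    forall phi u, cmeas phi ->
      mu.-integrable setT (EFin \o (fun s => cabs (phi s))) ->
      represents u f phi ->
      represents (iter k op u) g phi /\
      forall j z, (j < k)%N -> cabs z < 1 -> has_partials (iter j op u) z.
Proof.
move=> hop; elim=> [|k IHk] n f rf; first by exists f => // phi u _ _ uf; split.
have [g rg hg] := IHk n f rf; have [g' rg' hg'] := hop _ _ rg.
exists g' => // phi u mphi iphi uf.
have [ug pg] := hg _ _ mphi iphi uf; have [ug' pg'] := hg' _ _ mphi iphi ug.
split=> // j z; rewrite ltnS leq_eqVlt => /orP[/eqP ->|jk] z1; first exact: pg'.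
exact: pg.
Qed.

Lemma represents_dz_dzbar k l f : rat_ker 0 f ->
  exists2 g, rat_ker (k + l) g & forall phi u, cmeas phi ->
    mu.-integrable setT (EFin \o (fun s => cabs (phi s))) ->
    represents u f phi ->
    dz_dzbar_exists k l u /\ represents (dz_dzbar k l u) g phi.
Proof.
move=> rf.
have hdz n h : rat_ker n h -> exists2 g, rat_ker n.+1 g &
    forall phi u, cmeas phi ->
      mu.-integrable setT (EFin \o (fun s => cabs (phi s))) ->
      represents u h phi ->
      represents (dz u) g phi /\ forall z, cabs z < 1 -> has_partials u z.
  move=> /represents_partials[p [q [rp _ H]]]; exists p => // phi u mphi iphi uh.
  by split=> z z1; have [] := H phi u mphi iphi uh z z1.
have hdzbar n h : rat_ker n h -> exists2 g, rat_ker n.+1 g &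
    forall phi u, cmeas phi ->
      mu.-integrable setT (EFin \o (fun s => cabs (phi s))) ->
      represents u h phi ->
      represents (dzbar u) g phi /\ forall z, cabs z < 1 -> has_partials u z.
  move=> /represents_partials[p [q [_ rq H]]]; exists q => // phi u mphi iphi uh.
  by split=> z z1; have [] := H phi u mphi iphi uh z z1.
have [g rg hg] := represents_iter hdzbar l rf.
have [g' rg' hg'] := represents_iter hdz k rg.
rewrite addn0 in rg'.
exists g' => // phi u mphi iphi uf.
have [ug pg] := hg _ _ mphi iphi uf; have [ug' pg'] := hg' _ _ mphi iphi ug.
split=> // z z1; split=> j jl; first exact: pg.
exact: pg'.
Qed.

End IteratedDerivatives.

Theorem theorem3p9 (R : realType) (alpha beta : R[i])
    (halpha : forall n : nat, alpha != - n.+1%:R)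
    (hbeta : forall n : nat, beta != - n.+1%:R)
    (hab : -1 < complex.Re alpha + complex.Re beta)
    (p : \bar R) (hp : (1%:E <= p)%E) (k l : nat) :
  exists C : R, forall phi : borel_circle R -> R[i], in_Lp p phi ->
    let u := poisson alpha beta phi in
    dz_dzbar_exists k l u /\
    forall z : R[i], cabs z < 1 ->
      cabs (dz_dzbar k l u z) <=
        C * (fine (circle_norm p phi) /
             (1 - cabs z ^+ 2) `^ (k%:R + l%:R + fine (p^-1)%E)).
Proof.
have sg0 : 0 < Re alpha + Re beta + 1 by rewrite -ltrBlDr sub0r.
have [g rg hg] := represents_dz_dzbar sg0 k l (rat_cst (c_const alpha beta)).
have [C1 C10 hC1] := ukernel_rat_bound alpha beta rg.
have [C2 C20 hC2] := kernel_Lp sg0 hp.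
(* 2 is the cost of the two components, C1 the pointwise kernel bound, C2 the L^p estimate. *)
exists (2 * (C1 * C2)) => phi Lphi u.
have [mr mi _] := Lphi; have mphi : cmeas phi by [].
have iphi := integrable_normc hp Lphi.
(* The constant c_(alpha,beta) is the initial rational factor, of weight 0. *)
have repr : represents alpha beta u (fun _ _ => c_const alpha beta) phi.
  move=> z z1; rewrite /u /poisson /kernel_int; congr circle_integral.
  by apply/funext => s; rewrite u_kernelE [c_const _ _ * _]mulrC.
have [ex rep] := hg phi u mphi iphi repr; split=> // z z1.
rewrite (rep z z1) /kernel_int.
have a0 := one_sub_sqr_gt0 z1; set a := 1 - cabs z ^+ 2 in a0 *.
set N := fine _; set sg := Re alpha + Re beta + 1 in sg0 hC1 hC2.
pose w := C1 / a ^+ (k + l).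
have w0 : 0 <= w by rewrite divr_ge0// exprn_ge0// ltW.
(* The exponent splits: k + l is the weight of [g], absorbed in [w], and 1/p comes from the L^p
   estimate. *)
have -> : 2 * (C1 * C2) * (N / a `^ (k%:R + l%:R + fine (p^-1)%E)) =
    2 * (w * (C2 * (N / a `^ fine (p^-1)%E))).
  rewrite powRD ?(gt_eqF a0) ?implybT// -natrD powR_mulrn ?(ltW a0)// /w.
  by field; rewrite !gt_eqF ?exprn_gt0 ?powR_gt0.
have mk : measurable_fun setT
    (fun s : borel_circle R => (majorant sg z s * cabs (phi s))%:E).
  exact: measurable_majorant_normc.
have k0int : (\int[@arc_measure R]_s (w * (majorant sg z s * cabs (phi s)))%:E <=
    (w * (C2 * (N / a `^ fine (p^-1)%E)))%:E)%E.
  under eq_integral do rewrite EFinM.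
  rewrite ge0_integralZl_EFin//.
    by rewrite [leRHS]EFinM lee_wpmul2l ?lee_fin// hC2.
  by move=> s _; rewrite lee_fin mulr_ge0 ?majorant_ge0 ?normc_ge0.
apply: (normc_circle_integral _ _ _ k0int).
- exact: (cmeas_kernel _ _ mphi rg z1).
(* The integral bound just proved is finite, which gives integrability of the dominating
   function. *)
- apply/integrableP; split.
    apply/measurable_EFinP; apply: measurable_funM => //.
    exact/measurable_EFinP.
  apply: le_lt_trans (ltry _); apply: le_trans k0int.
  rewrite le_eqVlt; apply/orP; left; apply/eqP; apply: eq_integral => s _ /=.
  by rewrite ger0_norm// mulr_ge0// mulr_ge0 ?majorant_ge0 ?normc_ge0.
- by move=> s; rewrite Normc.normcM mulrA ler_wpM2r ?normc_ge0// hC1.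
Qed.
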